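(* Let $n\ge 3$, let $k$ be a field, and let $C_n$ be the Hecke--Kiselman monoid associated to the oriented cycle with $n$ vertices. Let $S$ and $S'\subseteq S$ be the sets of reductions (pairs of words in the free monoid $F$ on $x_1,\dots,x_n$) defined in the context. Then $G'=\{w-w' : (w,w')\in S'\}\subseteq k[F]$ is a finite Gröbner basis of the algebra $k[C_n]$, and $G=\{w-w' : (w,w')\in S\}\subseteq k[F]$ is a Gröbner basis of $k[C_n]$. Consequently, the $S'$-reduced words form a basis of $k[C_n]$ over $k$.
   Context: $C_n$ ($n\ge3$) is the monoid generated by $x_1,\dots,x_n$ with relations $x_i^2=x_i$ and $x_ix_{i+1}x_i=x_{i+1}x_ix_{i+1}=x_ix_{i+1}$ for $i=1,\dots,n$ (indices modulo $n$), and $x_ix_j=x_jx_i$ for all $i,j\in\{1,\dots,n\}$ with $1<i-j<n-1$. It is the Hecke--Kiselman monoid of the oriented cycle with arrows $x_i\to x_{i+1}$ (indices modulo $n$). $k[C_n]$ is its monoid algebra. $F$ is the free monoid on $x_1,\dots,x_n$ (empty word $1$), with the deg-lex order (first by length, then lexicographically) extending $x_1<\cdots<x_n$. $|w|_x$ denotes the number of occurrences of the generator $x$ in $w$. A word $u$ is a factor of $v$ if $v=aub$ with $a,b\in F$. The notation $x_i\cdots x_j$ means the product of consecutive generators from $x_i$ up to $x_j$ if $i<j$, down to $x_j$ if $i>j$, and $x_i$ if $i=j$. In the cycle, for a word $u$: $u\nrightarrow x_i$ means $|u|_{x_i}=|u|_{x_{i-1}}=0$ (with $x_{i-1}=x_n$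 for $i=1$), and $x_i\nrightarrow u$ means $|u|_{x_i}=|u|_{x_{i+1}}=0$ (with $x_{i+1}=x_1$ for $i=n$). $S$ consists of all pairs: (1) $(x_ix_i,x_i)$, $i\in\{1,\dots,n\}$; (2) $(x_jx_i,x_ix_j)$, $i,j\in\{1,\dots,n\}$ with $1<j-i<n-1$; (3) $(x_n(x_1\cdots x_i)x_j,\;x_jx_n(x_1\cdots x_i))$, $i,j\in\{1,\dots,n\}$ with $i+1<j<n-1$; (4) $(x_iux_i,x_iu)$, $i\in\{1,\dots,n\}$, $1\ne u\in F$ with $u\nrightarrow x_i$; (5) $(x_ivx_i,vx_i)$, $i\in\{1,\dots,n\}$, $1\neq v\in F$ with $x_i\nrightarrow v$. $S'$ is the subset of $S$ consisting of (indices modulo $n$): (i) all pairs of type (1)--(3); (ii) all pairs $(x_iux_i,x_iu)$ of type (4) such that $|u|_{x_j}\le1$ for $j\in\{1,\dots,n\}\setminus\{i,i-1\}$; (iii) all pairs $(x_ivx_i,vx_i)$ of type (5) such that $|v|_{x_j}\le 1$ for $j\in\{1,\dots,n\}\setminus\{i,i+1\}$; (iv) all pairs $(x_izx_i,zx_i)$ of type (5) such that $i<n$ and $x_izx_i=x_i(x_{i_1}\cdots x_{j_1})(x_{i_2}\cdots x_{j_2})\cdots(x_{i_k}\cdots x_{j_k})x_n(x_1\cdots x_i)$, where $k\geq 1$, $i_1<i_2<\cdots<i_k<n$ and $j_1<j_2<\cdots<j_k<n$. A word is $S'$-reduced if none of its factors is the first component of a pair in $S'$. Let $J=\ker(k[F]\to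 k[C_n])$ for the natural homomorphism. A subset $G\subseteq J$ is a Gröbner basis of $k[C_n]$ if $0\notin G$, $G$ generates $J$ as an ideal, and for every nonzero $f\in J$ there is $g\in G$ whose leading monomial (in deg-lex order) is a factor of the leading monomial of $f$. *)

(* Defs.v *)
From HB Require Import structures.
From mathcomp Require Import all_boot all_order all_algebra finmap.
From mathcomp Require Import boolp classical_sets functions cardinality.
From mathcomp Require Import monalg.

Set Implicit Arguments.
Unset Strict Implicit.
Unset Printing Implicit Defensive.

Import GRing.Theory.

Local Open Scope quotient_scope.
Local Open Scope ring_scope.

(* The generator x_a (1 <= a <= n) is the ordinal of value a - 1, so that x_a
   is written (i : 'I_n) with a = i.+1.  Indices modulo n are handled by
   [ordS] and [ord_pred]. *)

Definition F (n : nat) := {fmonom 'I_n}.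
HB.instance Definition _ n := MonomialDef.on (F n).

Inductive hk_rel (n : nat) : seq 'I_n -> seq 'I_n -> Prop :=
| HKidem i : hk_rel [:: i; i] [:: i]
| HKbraidl i : hk_rel [:: i; ordS i; i] [:: i; ordS i]
| HKbraidr i : hk_rel [:: ordS i; i; ordS i] [:: i; ordS i]
| HKcomm (i j : 'I_n) : (1 < i - j < n - 1)%N -> hk_rel [:: i; j] [:: j; i].

Inductive hk_cong (n : nat) : F n -> F n -> Prop :=
| HKrel u v : hk_rel u v -> hk_cong (FMonom u) (FMonom v)
| HKrefl u : hk_cong u u
| HKsym u v : hk_cong u v -> hk_cong v u
| HKtrans u v w : hk_cong u v -> hk_cong v w -> hk_cong u w
| HKmul u v u' v' :
    hk_cong u v -> hk_cong u' v' -> hk_cong (mmul u u') (mmul v v').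

Definition hk_congb (n : nat) : rel (F n) := fun u v => `[< hk_cong u v >].

Lemma hk_congb_refl n : reflexive (@hk_congb n).
Proof. by move=> u; apply/asboolP; exact: HKrefl. Qed.

Lemma hk_congb_sym n : symmetric (@hk_congb n).
Proof. by move=> u v; apply/asboolP/asboolP; exact: HKsym. Qed.

Lemma hk_congb_trans n : transitive (@hk_congb n).
Proof.
by move=> v u w /asboolP uv /asboolP vw; apply/asboolP; exact: HKtrans uv vw.
Qed.

Canonical hk_equiv (n : nat) :=
  EquivRel (@hk_congb n) (@hk_congb_refl n) (@hk_congb_sym n)
    (@hk_congb_trans n).

Definition C (n : nat) := {eq_quot (hk_equiv n)}.
HB.instance Definition _ n := Choice.on (C n).
HB.instance Definition _ n := EqQuotient.on (C n).

Lemma C_eqP n (u v : F n) : \pi_(C n) u = \pi_(C n) v <-> hk_cong u v.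
Proof.
split=> [/eqP|uv]; first by rewrite piE => /asboolP.
by apply/eqP; rewrite piE; apply/asboolP.
Qed.

Definition C1 (n : nat) : C n := \pi_(C n) mone.
Definition Cmul (n : nat) (x y : C n) : C n := \pi_(C n) (mmul (repr x) (repr y)).

Lemma Cmul_pi n (u v : F n) :
  Cmul (\pi_(C n) u) (\pi_(C n) v) = \pi_(C n) (mmul u v).
Proof. by apply/C_eqP/HKmul; apply/C_eqP; rewrite reprK. Qed.

Lemma repr_pi_cong n (u : F n) : hk_cong (repr (\pi_(C n) u)) u.
Proof. by apply/C_eqP; rewrite reprK. Qed.

Lemma CmulA n : associative (@Cmul n).
Proof.
move=> x y z; apply/C_eqP.
apply: HKtrans (HKmul (HKrefl _) (repr_pi_cong _)) _; rewrite mulmA.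
exact: HKmul (HKsym (repr_pi_cong _)) (HKrefl _).
Qed.

Lemma Cmul1m n : left_id (C1 n) (@Cmul n).
Proof.
move=> x; rewrite -[RHS]reprK; apply/C_eqP.
by rewrite -[X in hk_cong _ X]mul1m; apply: HKmul (repr_pi_cong _) (HKrefl _).
Qed.

Lemma Cmulm1 n : right_id (C1 n) (@Cmul n).
Proof.
move=> x; rewrite -[RHS]reprK; apply/C_eqP.
by rewrite -[X in hk_cong _ X]mulm1; apply: HKmul (HKrefl _) (repr_pi_cong _).
Qed.

Lemma hk_cong_eq1 n (u v : F n) : hk_cong u v -> (u == mone) = (v == mone).
Proof.
elim=> {u v} [u v|//|//|u v w _ -> //|u v u' v' _ uv _ uv'].
  by rewrite !fmP !fm1; case.
by rewrite !fmM_eq1 uv uv'.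
Qed.

Lemma Cunitm n (x y : C n) : Cmul x y = C1 n -> x = C1 n /\ y = C1 n.
Proof.
move=> /C_eqP/hk_cong_eq1; rewrite eqxx fmM_eq1 => /andP[/eqP x1 /eqP y1].
by rewrite -[x]reprK -[y]reprK x1 y1.
Qed.

HB.instance Definition _ n :=
  Choice_isMonomialDef.Build (C n) (@CmulA n) (@Cmul1m n) (@Cmulm1 n) (@Cunitm n).

Definition word_img (k : fieldType) (n : nat) (w : F n) : {malg k[C n]} :=
  << \pi_(C n) w >>.

Arguments word_img k {n} w.

Definition nat_hom (k : fieldType) (n : nat) : {malg k[F n]} -> {malg k[C n]} :=
  mmap (@malgC (C n) k) (word_img k).

Definition J (k : fieldType) (n : nat) : set {malg k[F n]} :=
  [set f | nat_hom f = 0].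

Arguments J k n f : clear implicits.

(* On words of equal length the order of [seqlexi 'I_n] is the lexicographic
   order extending x_1 < ... < x_n. *)
Definition deglex (n : nat) (u v : F n) : bool :=
  (size u < size v)%N || (size u == size v)
    && ((u : seqlexi 'I_n) <= (v : seqlexi 'I_n))%O.

Definition deglex_max (n : nat) (u v : F n) : F n := if deglex u v then v else u.

(* The empty word is the least word, hence a neutral element; the value on 0 is
   irrelevant. *)
Definition lead_mon (k : fieldType) (n : nat) (f : {malg k[F n]}) : F n :=
  \big[@deglex_max n/mone]_(w <- msupp f) w.

Definition two_sided_ideal (R : nzRingType) (I : set R) : Prop :=
  [/\ I 0,
      forall f g, I f -> I g -> I (f + g)
    & forall a f, I f -> I (a * f) /\ I (f * a)].

Definition ideal_gen (R : nzRingType) (G : set R) : set R :=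
  [set f | forall I : set R, two_sided_ideal I -> (G `<=` I)%classic -> I f].

Definition grobner_basis (k : fieldType) (n : nat) (G : set {malg k[F n]}) :
    Prop :=
  [/\ (G `<=` J k n)%classic,
      ~ G 0,
      ideal_gen G = J k n
    & forall f, J k n f -> f != 0 ->
        exists2 g, G g & infix (lead_mon g) (lead_mon f)].

(* x_i ... x_j, read upwards if i <= j and downwards if i > j *)
Definition run (n : nat) (i j : 'I_n) : seq 'I_n :=
  if (i <= j)%N then [seq l : 'I_n <- enum 'I_n | (i <= l <= j)%N]
  else rev [seq l : 'I_n <- enum 'I_n | (j <= l <= i)%N].

Definition no_arrow_to (n : nat) (u : seq 'I_n) (i : 'I_n) : bool :=
  (count_mem i u == 0%N) && (count_mem (ord_pred i) u == 0%N).

Definition no_arrow_from (n : nat) (i : 'I_n) (u : seq 'I_n) : bool :=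
  (count_mem i u == 0%N) && (count_mem (ordS i) u == 0%N).

(* In the rules below [x1] and [xn] are x_1 and x_n. *)

Inductive red123 (n : nat) : seq 'I_n * seq 'I_n -> Prop :=
| Red1 i : red123 ([:: i; i], [:: i])
| Red2 (i j : 'I_n) : (1 < j - i < n - 1)%N -> red123 ([:: j; i], [:: i; j])
| Red3 (x1 xn i j : 'I_n) :
    x1 = 0%N :> nat -> xn.+1 = n -> (i.+1 + 1 < j.+1 < n - 1)%N ->
    red123 (xn :: run x1 i ++ [:: j], j :: xn :: run x1 i).

Inductive redS (n : nat) : seq 'I_n * seq 'I_n -> Prop :=
| S123 p : red123 p -> redS p
| S4 i u : u != [::] -> no_arrow_to u i -> redS (i :: u ++ [:: i], i :: u)
| S5 i v : v != [::] -> no_arrow_from i v ->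
    redS (i :: v ++ [:: i], v ++ [:: i]).

Inductive redS' (n : nat) : seq 'I_n * seq 'I_n -> Prop :=
| S'123 p : red123 p -> redS' p
| S'4 i u : u != [::] -> no_arrow_to u i ->
    (forall j, j != i -> j != ord_pred i -> (count_mem j u <= 1)%N) ->
    redS' (i :: u ++ [:: i], i :: u)
| S'5 i v : v != [::] -> no_arrow_from i v ->
    (forall j, j != i -> j != ordS i -> (count_mem j v <= 1)%N) ->
    redS' (i :: v ++ [:: i], v ++ [:: i])
(* [bs] lists the pairs (i_1, j_1), ..., (i_k, j_k); the two sortedness
   conditions say i_1 < ... < i_k < n and j_1 < ... < j_k < n in terms of the
   labels 1, ..., n. *)
| S'5run (x1 xn i : 'I_n) z (bs : seq ('I_n * 'I_n)) :
    x1 = 0%N :> nat -> xn.+1 = n ->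
    z != [::] -> no_arrow_from i z ->
    (i.+1 < n)%N -> (1 <= size bs)%N ->
    sorted ltn (rcons [seq (val b.1).+1 | b <- bs] n) ->
    sorted ltn (rcons [seq (val b.2).+1 | b <- bs] n) ->
    i :: z ++ [:: i] =
      i :: flatten [seq run b.1 b.2 | b <- bs] ++ xn :: run x1 i ->
    redS' (i :: z ++ [:: i], z ++ [:: i]).

Arguments redS n p : clear implicits.
Arguments redS' n p : clear implicits.

Definition binomials (k : fieldType) (n : nat)
    (R : set (seq 'I_n * seq 'I_n)) : set {malg k[F n]} :=
  [set << FMonom p.1 >> - << FMonom p.2 >> | p in R]%classic.

Arguments binomials k {n} R.

Definition reduced (n : nat) (R : set (seq 'I_n * seq 'I_n)) : set (F n) :=
  [set w | forall p, R p -> ~~ infix p.1 w].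

(* The family (b i), i in P; finitely supported families of scalars are elements
   of {malg k[I]}. *)
Definition basis_family (k : fieldType) (V : lmodType k) (I : choiceType)
    (P : set I) (b : I -> V) : Prop :=
  (forall c : {malg k[I]}, (forall i, i \in msupp c -> P i) ->
     \sum_(i <- msupp c) c@_i *: b i = 0 -> c = 0) /\
  (forall v : V, exists2 c : {malg k[I]}, (forall i, i \in msupp c -> P i) &
     v = \sum_(i <- msupp c) c@_i *: b i).

(* Main.v *)
Require Import Defs.
From HB Require Import structures.
From mathcomp Require Import all_boot all_order all_algebra finmap.
From mathcomp Require Import boolp classical_sets functions cardinality.
From mathcomp Require Import monalg.
From mathcomp Require Import zify.

Set Implicit Arguments.
Unset Strict Implicit.
Unset Printing Implicit Defensive.

(** The letters are numbered [0, ..., N] with [N = n - 1] and read modulo [n].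
    The monoid acts on the natural numbers: the letter [a] moves a token from [p]
    to [p + 1] when [p] is congruent to [a], and leaves the other tokens where
    they are.  The defining relations hold for
    this action, so the map [walk w] only depends on the class of [w]
    ([walk_cong]).  The heart of the proof is that a word in which no left-hand
    side of the smaller set of rules occurs is determined by its walk
    ([walk_inj]): then every class contains exactly one irreducible word, which
    is what confluence would give, and no overlap of rules has to be resolved.

    Call a word interlaced when between two consecutive occurrences of a letter
    [a] both [a - 1] and [a + 1] occur.  An interlaced word merges two neighbouring
    tokens exactly when the letter under the one behind occurs and comes first
    ([walk_lt], [walk_merge]), and this makes it possible to read off from the
    walk which letters can be commuted to the front of the word
    ([first_letter]), and the walk of what remains after one of them is removed
    ([walk_tail]).  If [u] and [v] are irreducible with the same walk and begin
    with letters [a < b], then [a] occurs in [v] after letters that all commute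
    with it.  Going down from [b] to below [a] without meeting a forbidden
    factor is only possible through the passage from [N] to [0], and from there
    the word has to climb by steps of one through [a - 1], which does not commute
    with [a] ([no_crossing]).  So [a = b], and induction applies.

    That irreducible words are interlaced ([irr_interlaced]) is the reason why
    finitely many rules are enough.  In a word [a u a] with [u] interlaced and
    without [a - 1], the same descents and climbs force all letters of [u] to be
    distinct; if instead [a + 1] is missing, either the letters are again
    distinct or [u] is a product of descending runs followed by
    [N, 0, 1, ..., a - 1].  Each of these shapes is a left-hand side.

    It remains to see that the rules hold in the monoid ([redS_cong]) and lower
    the order ([redS_code]).  Every word [w] then has a normal form [w'],
    irreducible, congruent to [w] and not larger, with [w - w'] in the ideal
    generated by the rules.  Distinct irreducible words have distinct images, so
    a combination of irreducible words that maps to zero is zero; the ideal, the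
    leading monomials and the basis follow from this. *)

(** * Walks of tokens on the cycle *)

Section Cyclic.
Context (n : nat).
Implicit Types (a b c i p q : nat) (u v w : seq nat).

Definition csucc a := a.+1 %% n.
Definition cpred a := (a + n.-1) %% n.

Lemma csuccE a : a < n -> csucc a = if a.+1 == n then 0 else a.+1.
Proof.
rewrite /csucc => an; case: eqP => [->|ne]; first exact: modnn.
by rewrite modn_small //; lia.
Qed.

Lemma cpredE a : a < n -> cpred a = if a == 0 then n.-1 else a.-1.
Proof.
rewrite /cpred => an; case: eqP => [->|ne]; first by rewrite modn_small //; lia.
have -> : a + n.-1 = a.-1 + n by lia.
by rewrite modnDr modn_small //; lia.
Qed.

Lemma csucc_mod p : csucc (p %% n) = p.+1 %% n.
Proof. by rewrite /csucc -addn1 modnDml addn1. Qed.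

Definition act p c := if p %% n == c then p.+1 else p.
Definition walk w p := foldl act p w.

Lemma leq_walk w p : p <= walk w p.
Proof.
elim: w p => //= c w IH p; apply: leq_trans (IH _).
by rewrite /act; case: ifP.
Qed.

Lemma walk_notin w p : p %% n \notin w -> walk w p = p.
Proof.
elim: w => //= c w IH; rewrite inE negb_or => /andP[/negbTE pc pw].
by rewrite /act pc IH.
Qed.

Lemma walk_mem w p : p %% n \in w -> p < walk w p.
Proof.
elim: w => //= c w IH; rewrite inE /act; case: eqP => [->|_] //= _.
exact: leq_walk.
Qed.

Lemma walk_period w p : walk w (p + n) = walk w p + n.
Proof.
elim: w p => //= c w IH p.
by rewrite -IH /act modnDr; case: ifP; rewrite ?addSn.
Qed.

(** The condition at each occurrence of [a] only concerns the next one, so that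
    [interlaced] is inherited by the tail of a word. *)
Fixpoint interlaced w :=
  if w is a :: u then
    interlaced u && ((a \in u) ==>
      (index (csucc a) u < index a u) && (index (cpred a) u < index a u))
  else true.

Lemma interlaced_cat u v : interlaced (u ++ v) -> interlaced u && interlaced v.
Proof.
elim: u => //= a u IH /andP[/IH/andP[-> ->]]; rewrite mem_cat andbT /=.
move/implyP => H; apply/implyP => au; move: H; rewrite au => /(_ isT).
rewrite !index_cat au; have := index_mem a u; rewrite au => /idP au'.
move: (index_mem (csucc a) u) (index_mem (cpred a) u).
by case: ifP => nu; case: ifP => pu; lia.
Qed.

Lemma interlaced_catl u v : interlaced (u ++ v) -> interlaced u.
Proof. by case/interlaced_cat/andP. Qed.

Lemma interlaced_catr u v : interlaced (u ++ v) -> interlaced v.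
Proof. by case/interlaced_cat/andP. Qed.

Context (hn : 2 < n).

Lemma cpred_mod p : cpred (p.+1 %% n) = p %% n.
Proof.
rewrite /cpred modnDml; have -> : p.+1 + n.-1 = p + n by lia.
by rewrite modnDr.
Qed.

Lemma csucc_neq a : a < n -> (csucc a == a) = false.
Proof. by move=> an; rewrite csuccE //; case: ifP; lia. Qed.

Lemma cpred_neq a : a < n -> (cpred a == a) = false.
Proof. by move=> an; rewrite cpredE //; case: ifP; lia. Qed.

Lemma walk_idem a p : a < n -> walk [:: a; a] p = walk [:: a] p.
Proof.
move=> an; rewrite /= /act; case: (eqVneq (p %% n) a) => [pa|/negbTE -> //].
by rewrite -csucc_mod pa csucc_neq.
Qed.

(** All three words send tokens on [a] and on [a + 1] to [a + 2], where they stay: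
    [a + 2] differs from [a] because the cycle has length at least three. *)
Lemma walk_braid a p : a < n ->
  walk [:: a; csucc a; a] p = walk [:: a; csucc a] p /\
  walk [:: csucc a; a; csucc a] p = walk [:: a; csucc a] p.
Proof.
move=> an.
have bn : csucc a < n by rewrite ltn_mod; lia.
have ab := csucc_neq an; have bb := csucc_neq bn.
have ba : (csucc (csucc a) == a) = false.
  by rewrite (csuccE bn) (csuccE an); case: ifP; case: ifP; lia.
rewrite /= /act; case: (eqVneq (p %% n) a) => [pa|/negbTE pa].
  by rewrite pa [a == _]eq_sym ab pa eqxx -!csucc_mod pa eqxx -!csucc_mod pa ba.
case: (eqVneq (p %% n) (csucc a)) => [pb|/negbTE pb]; rewrite ?pa ?pb //.
by rewrite ?ab -!csucc_mod pb ba ?bb -?csucc_mod ?pb ?bb.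
Qed.

Lemma walk_comm a b p : a < n -> b < n -> a != b -> csucc a != b -> csucc b != a ->
  walk [:: a; b] p = walk [:: b; a] p.
Proof.
move=> an bn /negbTE ab /negbTE nab /negbTE nba; rewrite /= /act.
case: (eqVneq (p %% n) a) => [pa|/negbTE pa].
  by rewrite -csucc_mod pa nab ab pa eqxx.
case: (eqVneq (p %% n) b) => [pb|/negbTE pb]; last by rewrite pa.
by rewrite -csucc_mod pb nba.
Qed.

(** Tokens on [q] and [q + 1] merge only when the letter [q] is read before
    [q + 1].  If the token ahead moves from [q + 1] to [q + 2], interlacing says
    that [q + 2] comes again before [q + 1]: the hypothesis is kept for the new
    position, whatever the distance to the token behind. *)
Lemma walk_lt w p q : interlaced w -> p <= q ->
  (q %% n \in w -> index (q.+1 %% n) w < index (q %% n) w) ->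
  walk w p < walk w q.+1.
Proof.
elim: w p q => //= c w IH p q /andP[iw ic] pq H.
rewrite /act; case: (eqVneq (q.+1 %% n) c) => [qc|qc].
  apply: IH => //; first by case: ifP; lia.
  by rewrite qc -csucc_mod qc => cw; move/implyP: ic => /(_ cw) /andP[].
move: H; rewrite inE [c == q.+1 %% n]eq_sym (negbTE qc) => H.
case: (eqVneq c (q %% n)) H => [_ /(_ isT) //|cq].
rewrite /= ltnS => H; apply: IH => //.
case: eqP => // pc; rewrite ltn_neqAle pq andbT.
by apply: contra cq => /eqP <-; rewrite pc.
Qed.

Lemma walk_merge w p : index (p %% n) w < index (p.+1 %% n) w ->
  walk w p = walk w p.+1.
Proof.
elim: w p => //= c w IH p; rewrite /act.
case: (eqVneq c (p %% n)) => cp; case: (eqVneq c (p.+1 %% n)) => //= cq.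
by rewrite ltnS; exact: IH.
Qed.

Lemma interlaced_between x a u y : interlaced (x ++ a :: u ++ a :: y) ->
  a \notin u -> a < n -> (csucc a \in u) && (cpred a \in u).
Proof.
move=> /interlaced_catr /= /andP[_ /implyP H] au an; move: H.
rewrite mem_cat mem_head orbT => /(_ isT).
rewrite !index_cat (negbTE au) /= eqxx addn0 ![a == _]eq_sym.
rewrite csucc_neq // cpred_neq //.
case: ifP => nu; last by lia.
by case: ifP => pu; lia.
Qed.

(** In [a :: u] the tokens on [a] and [a + 1] merge and those on [a - 1] and [a]
    do not.  Reading this in [v] forbids that [a + 1] or [a - 1] precede [a]. *)
Lemma first_letter a u v : a < n ->
  interlaced (a :: u) -> interlaced v -> walk (a :: u) =1 walk v ->
  [/\ a \in v, index a v < index (csucc a) v & index a v < index (cpred a) v].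
Proof.
move=> an iau iv E.
have am : a %% n = a by rewrite modn_small.
have m1 : walk (a :: u) a = walk (a :: u) a.+1.
  rewrite /= /act am eqxx; case: eqP => // e.
  by have := csucc_neq an; rewrite /csucc e eqxx.
have av : a \in v.
  apply: contraT => nv; have := E a; rewrite [RHS]walk_notin ?am //.
  by rewrite /= /act am eqxx => e; have := leq_walk u a.+1; lia.
have ind x : x != a -> (index a v < index x v) = ~~ (index x v < index a v).
  move=> xa; rewrite -leqNgt ltn_neqAle; case: (eqVneq (index a v)) => // e.
  have xv : x \in v by rewrite -index_mem -e index_mem.
  by move: xa; rewrite -(nth_index 0 xv) -e nth_index // eqxx.
split=> //; rewrite ind ?csucc_neq ?cpred_neq //; apply/negP => lt.
  have := walk_lt (p := a) (q := a) iv (leqnn a).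
  by rewrite am -/(csucc a) => /(_ (fun=> lt)); rewrite -!E m1 ltnn.
(* the token on a - 1, shifted by n to remain a natural number *)
pose p := a + n.-1.
have pE : p %% n = cpred a by [].
have p1 : p.+1 %% n = a.
  have -> : p.+1 = a + n by rewrite /p; lia.
  by rewrite modnDr.
have := walk_lt (p := p) (q := p) iau (leqnn p).
rewrite p1 pE => H; have := walk_merge (w := v) (p := p); rewrite p1 pE => /(_ lt).
rewrite -!E => e; move: H; rewrite e ltnn => H.
suff : false by []; apply: H.
by rewrite /= eqxx eq_sym cpred_neq.
Qed.

(** The first letter [a] hides the token on [a] from the walk of [a :: u].  It is
    recovered from the token on [a - 1]: interlacing puts [a - 1] before the next
    [a], so either that token joins the one on [a], or neither moves. *)
Lemma walk_under_first_letter a u q : a < n -> interlaced (a :: u) ->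
  q.+1 %% n = a ->
  walk u q.+1 = if q < walk u q then walk u q else q.+1.
Proof.
move=> an /= /andP[iu /implyP ia] qa.
have pq : cpred a = q %% n by rewrite -qa cpred_mod.
case: ifPn => [qw|].
  apply/esym/walk_merge; rewrite qa.
  case: (boolP (a \in u)) => [/ia/andP[_]|/memNindex ->]; first by rewrite pq.
  rewrite index_mem; apply: contraTT qw => /walk_notin ->; by rewrite ltnn.
rewrite -leqNgt => wq; apply: walk_notin; rewrite qa.
apply/negP => /ia/andP[_]; rewrite pq => lt.
have : q %% n \in u by rewrite -index_mem (leq_trans lt) // index_size.
by move/walk_mem; lia.
Qed.

Lemma walk_tail a u v : a < n ->
  interlaced (a :: u) -> interlaced (a :: v) -> walk (a :: u) =1 walk (a :: v) ->
  walk u =1 walk v.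
Proof.
move=> an iu iv E.
have ne p : p %% n != a -> walk u p = walk v p.
  by move=> pa; have := E p; rewrite /= /act (negbTE pa).
have pos q : walk u q.+1 = walk v q.+1.
  case: (eqVneq (q.+1 %% n) a) => [qa|]; last exact: ne.
  rewrite (walk_under_first_letter an iu qa) (walk_under_first_letter an iv qa).
  by rewrite ne // -(cpred_mod q) qa cpred_neq.
case=> [|p]; last exact: pos.
apply: (@addIn n); rewrite -!walk_period add0n.
by have -> : n = n.-1.+1 by lia.
Qed.

End Cyclic.

(** * Irreducible words *)

Lemma split_last (T : Type) (P : pred T) s : has P s ->
  exists s1 y s2, [/\ s = s1 ++ y :: s2, P y & ~~ has P s2].
Proof.
elim: s => //= x s IH; case: (boolP (has P s)) => [/IH[s1 [y [s2 [-> Py ns]]]] _|ns].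
  by exists (x :: s1), y, s2.
by rewrite orbF => Px; exists [::], x, s.
Qed.

Lemma split_first (T : eqType) (x : T) s : x \in s ->
  exists s1 s2, s = s1 ++ x :: s2 /\ x \notin s1.
Proof.
elim: s => //= y s IH; rewrite inE; case: (eqVneq x y) => [-> _|xy /=].
  by exists [::], s.
case/IH => s1 [s2 [-> xs]]; exists (y :: s1), s2.
by rewrite inE negb_or xy xs.
Qed.

Lemma iota_rcons m k : rcons (iota m k) (m + k) = iota m k.+1.
Proof. by rewrite -addn1 iotaD cats1. Qed.

Lemma iota_rcons0 k : rcons (iota 0 k) k = iota 0 k.+1.
Proof. exact: iota_rcons. Qed.

Definition descent j i := rev (iota i (j.+1 - i)).

Lemma mem_descent j i x : x \in descent j i = (i <= x <= j).
Proof. by rewrite mem_rev mem_iota; lia. Qed.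

Lemma descent_cons j i : i <= j.+1 -> descent j.+1 i = j.+1 :: descent j i.
Proof.
move=> ij; rewrite /descent subSn // -iota_rcons rev_rcons.
by have -> : i + (j.+1 - i) = j.+1 by lia.
Qed.

Lemma descent_id i : descent i i = [:: i].
Proof. by rewrite /descent subSnn. Qed.

Section ReducedWords.
Context (n : nat).
Context (hn : 2 < n).
Implicit Types (a b c i j p q : nat) (r s t u v w : seq nat).
Local Notation N := n.-1.
Local Notation csucc := (csucc n).
Local Notation cpred := (cpred n).
Local Notation interlaced := (interlaced n).

(** The left-hand sides of the smaller set of rules, for words in the letters
    [0, ..., N].  When [i] and a neighbour are absent from the inner word, the
    bounds on its multiplicities say that it has no repeated letter. *)
Inductive lhs : seq nat -> Prop :=
| LhsIdem i : lhs [:: i; i]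
| LhsSwap i j : 1 < j - i < N -> lhs [:: j; i]
| LhsClimb i j : i.+1 < j -> j.+1 < N -> lhs (N :: iota 0 i.+1 ++ [:: j])
| LhsNoPred i u : u != [::] -> i \notin u -> cpred i \notin u -> uniq u ->
    lhs (i :: u ++ [:: i])
| LhsNoSucc i v : v != [::] -> i \notin v -> csucc i \notin v -> uniq v ->
    lhs (i :: v ++ [:: i])
| LhsNoSuccRuns i v (bs : seq (nat * nat)) :
    v != [::] -> i \notin v -> csucc i \notin v -> i < N -> bs != [::] ->
    all (fun d => d.2 <= d.1) bs ->
    sorted ltn (rcons (map fst bs) N) -> sorted ltn (rcons (map snd bs) N) ->
    v = flatten [seq descent d.1 d.2 | d <- bs] ++ N :: iota 0 i ->
    lhs (i :: v ++ [:: i]).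

Definition irr w := all (gtn n) w /\ forall r, lhs r -> ~~ infix r w.

Lemma irr_infix u w : infix u w -> irr w -> irr u.
Proof.
move=> uw [wn wi]; split.
  by apply/allP => x /(mem_infix uw); apply/allP.
by move=> r lr; apply: contra (wi r lr) => pu; exact: infix_trans uw.
Qed.

Lemma irr_catl u v : irr (u ++ v) -> irr u.
Proof. by apply: irr_infix; exact: prefix_infix. Qed.

Lemma irr_catr u v : irr (u ++ v) -> irr v.
Proof. by apply: irr_infix; exact: suffix_infix. Qed.

Lemma irr_cons a u : irr (a :: u) -> irr u.
Proof. by rewrite -cat1s; exact: irr_catr. Qed.

Lemma irr_ltn w x : irr w -> x \in w -> x < n.
Proof. by case=> /allP H _ /H. Qed.

Lemma irr_lhs u v w : irr (u ++ v ++ w) -> ~ lhs v.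
Proof. by case=> _ H /H; rewrite infix_infix. Qed.

(** Two adjacent letters of an irreducible word that decrease do not commute:
    the step down has length one, or it is the passage from [N] to [0]. *)
Lemma irr_step y z t : irr (y :: z :: t) ->
  y < z \/ y = z.+1 \/ y = N /\ z = 0.
Proof.
move=> iw; have yn : y < n by apply: (irr_ltn iw); rewrite mem_head.
have nl : ~ lhs [:: y; z] by apply: (@irr_lhs [::] _ t).
case: (ltngtP y z) => [|zy|yz]; first by left.
  case: (boolP (1 < y - z < N)) => [/LhsSwap //|nb]; lia.
by case: nl; rewrite yz; constructor.
Qed.

Lemma no_valley y t : y.+1 < n -> ~ irr (y :: y.+1 :: y :: t).
Proof.
move=> yn iw; apply: (@irr_lhs [::] [:: y; y.+1; y] t) => //.
apply: (@LhsNoPred y [:: y.+1]) => //; first by rewrite inE; lia.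
rewrite inE cpredE //; last by lia.
by case: ifP; lia.
Qed.

(** After the letter [N], a word in letters below [N - 1] must climb from [0] by
    steps of one: a letter reached by a larger step could be moved in front of [N]
    and of the whole climb, and a step down creates a valley. *)
Lemma ascent s a : irr (N :: rcons s a) -> all (gtn n.-2) (rcons s a) ->
  s = iota 0 a.
Proof.
elim/last_ind: s a => [|s b IH] a.
  by move=> /irr_step st /andP[/= an _]; by have -> : a = 0 by lia.
move=> iw; rewrite all_rcons => /andP[an sn].
have sE : s = iota 0 b.
  by apply: IH => //; move: iw; rewrite -cats1 -cat_cons; exact: irr_catl.
have bn : b < n.-2 by move: sn; rewrite all_rcons => /andP[].
move: iw; rewrite -!cats1 -catA cat1s /= -cat_cons => iw.
have [ba|[ba|[]]] := irr_step (irr_catr iw); last by lia.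
  case: (eqVneq a b.+1) => [->|ne].
    by rewrite sE cats1 iota_rcons0.
  exfalso; apply: (@irr_lhs [::] (N :: s ++ [:: b; a]) [::]).
    by rewrite cats0.
  rewrite (_ : s ++ [:: b; a] = iota 0 b.+1 ++ [:: a]); last first.
    by rewrite -iota_rcons0 -sE -cats1 -catA.
  by apply: LhsClimb; move: an => /=; lia.
exfalso; move: iw; rewrite sE ba -iota_rcons0 -cats1 /= -catA -cat_cons.
move/irr_catr; apply: no_valley; lia.
Qed.

(** The last letter above [a] must be followed by a letter below [a].  Steps of
    one cannot jump over [a], so this is the passage from [N] to [0]; from there
    the word climbs up to [a], through [a - 1]. *)
Lemma no_crossing a b t : irr (b :: t ++ [:: a]) -> a < b ->
  a \notin b :: t -> csucc a \notin b :: t -> cpred a \notin b :: t -> False.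
Proof.
move=> iw ab na nna npa.
have an : a < n by apply: (irr_ltn iw); rewrite inE mem_cat mem_head !orbT.
have [|s1 [y [s2 [sE ay]]]] := @split_last _ (ltn a) (b :: t); first by rewrite /= ab.
rewrite -all_predC => /allP s2a.
move: iw; rewrite -cat_cons {}sE in na nna npa * => iw.
have yn : y < n by apply: (irr_ltn iw); rewrite !mem_cat mem_head !orbT.
have {}s2a x : x \in s2 -> x < a.
  move=> xs; have /= := s2a x xs; rewrite -leqNgt leq_eqVlt => /orP[/eqP xa|//].
  by move: na; rewrite mem_cat inE -xa xs !orbT.
have ay1 : a.+1 != y.
  move: nna; rewrite csuccE //; case: ifP => e; first by move: ay => /=; lia.
  by apply: contra => /eqP ->; rewrite mem_cat mem_head orbT.
move: iw; rewrite -catA /= => /irr_catr iw.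
(* the letter after y lies below a, or is a itself when y ends the word *)
have yN : y = N.
  have za z : z \in rcons s2 a -> y = z.+1 \/ y < z -> False.
    rewrite mem_rcons inE => /orP[/eqP->|/s2a]; move: ay ay1 => /=; lia.
  move: iw za; rewrite cats1; case: (rcons s2 a) (size_rcons s2 a) => // z s3 _.
  move=> /irr_step st /(_ z (mem_head _ _)) F.
  by case: st => [yz|[yz|[]]] //; case: F; [right|left].
have a2 : a < n.-2 by move: ay => /=; lia.
have s2n : all (gtn n.-2) (rcons s2 a).
  by rewrite all_rcons /= a2; apply/allP => x /s2a /=; lia.
move: iw; rewrite yN cats1 => /ascent/(_ s2n) sE.
case: a {na nna ay ay1 s2a s2n ab} sE npa an a2 => [|a] sE npa an a2.
  by move: npa; rewrite cpredE // mem_cat yN mem_head orbT.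
by move: npa; rewrite cpredE // sE mem_cat !inE mem_iota /=; lia.
Qed.

(** If [a < b] could be commuted to the front of [b :: v], the part of the word up
    to [a] would be excluded by [no_crossing]. *)
Lemma no_smaller_first_letter a b v : irr (b :: v) -> a < b -> a \in b :: v ->
  index a (b :: v) < index (csucc a) (b :: v) ->
  index a (b :: v) < index (cpred a) (b :: v) -> False.
Proof.
move=> iw ab /split_first[[|b' t] [v2 [E na]]]; first by case: E ab => ->; lia.
move: iw; rewrite E !index_cat (negbTE na) index_head addn0 => iw.
case: ifPn => [|nnx]; first by rewrite -index_mem; lia.
move=> _; case: ifPn => [|npx _]; first by rewrite -index_mem; lia.
apply: (@no_crossing a b' t) => //; last by case: E => <-.
by move: iw; rewrite -[a :: v2]cat1s catA; exact: irr_catl.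
Qed.

Lemma walk_inj u v : irr u -> irr v -> interlaced u -> interlaced v ->
  walk n u =1 walk n v -> u = v.
Proof.
elim: u v => [|a u IH] [|b v] //.
- move=> _ iv _ _ /(_ b) /=; have bn : b < n := irr_ltn iv (mem_head _ _).
  by rewrite /act modn_small // eqxx; have := leq_walk n v b.+1; lia.
- move=> iv _ _ _ /(_ a) /=; have an : a < n := irr_ltn iv (mem_head _ _).
  by rewrite /act modn_small // eqxx; have := leq_walk n u a.+1; lia.
move=> iu iv fu fv E.
have an : a < n := irr_ltn iu (mem_head _ _).
have bn : b < n := irr_ltn iv (mem_head _ _).
case: (ltngtP a b) => [ab|ba|ab].
- have [] := first_letter hn an fu fv E.
  by move=> *; exfalso; apply: (@no_smaller_first_letter a b v).
- have [] := first_letter hn bn fv fu (fsym E).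
  by move=> *; exfalso; apply: (@no_smaller_first_letter b a u).
rewrite ab in fu E *; congr (_ :: _).
apply: IH; rewrite ?(irr_cons iu) ?(irr_cons iv) //.
- exact: irr_cons iu.
- exact: irr_cons iv.
- by case/andP: fu.
- by case/andP: fv.
exact: (walk_tail hn bn fu fv E).
Qed.

End ReducedWords.

(** * Irreducible words are interlaced *)

Lemma descent_cat j i c : i <= c.+1 -> c <= j ->
  descent j i = descent j c.+1 ++ descent c i.
Proof.
move=> ic cj; rewrite /descent -rev_cat.
have -> : j.+1 - i = (c.+1 - i) + (j.+1 - c.+1) by lia.
by rewrite iotaD; have -> : i + (c.+1 - i) = c.+1 by lia.
Qed.

Lemma descent_head j i : i <= j -> exists t, descent j i = j :: t.
Proof.
case: j => [|j] ij; last by rewrite descent_cons //; exists (descent j i).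
by exists [::]; move: ij; rewrite leqn0 => /eqP ->.
Qed.

Section Interlacing.
Context (n : nat).
Context (hn : 2 < n).
Implicit Types (a b c i j m p q : nat) (r s t u v w : seq nat).
Local Notation N := n.-1.
Local Notation csucc := (csucc n).
Local Notation cpred := (cpred n).
Local Notation interlaced := (interlaced n).
Local Notation irr := (irr n).
Local Notation lhs := (lhs n).

Lemma interlaced_once u q : interlaced u -> q < n -> q \in u ->
  (csucc q \notin u) || (cpred q \notin u) ->
  exists u1 u2, [/\ u = u1 ++ q :: u2, q \notin u1 & q \notin u2].
Proof.
move=> iu qn /split_first[u1 [u2 [E0 q1]]]; rewrite E0 in iu *.
rewrite !mem_cat !inE !negb_or => H; exists u1, u2; split=> //.
apply/negP => /split_first[u3 [u4 [E q3]]]; rewrite E in iu H.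
have /andP[n3 p3] := interlaced_between hn iu q3 qn.
by move: H; rewrite !mem_cat n3 p3 /= !andbF.
Qed.

(** The case of interest is [m = a], a repeated letter [a] with [a - 1] absent in
    between.  The words [u] that occur end with a descent to [a + 1]; for a
    general [m] the descent has been removed down to its top [m], and the
    induction removes one more letter [m + 1].  Such a letter is present by
    [no_crossing], only once because [m] is absent, and it is followed by letters
    below [a] only if [m + 1 = N], when they form a climb from [0]. *)
Lemma uniq_before_descent a m u : a <= m < N -> irr (a :: u ++ [:: m]) ->
  interlaced u -> {in u, forall x, m < x \/ x.+1 < a} ->
  (a = 0 -> N \notin u) -> uniq u.
Proof.
move k_def : (N - m) => k; elim: k m u k_def => [|k IH] m u k_def; first by lia.
move=> /andP[am mN] iw iu H u0.
case uE0: u => [//|h u']; rewrite -uE0.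
have hm : m < h.
  have := H h; rewrite uE0 mem_head => /(_ isT).
  by move: iw; rewrite uE0 => /(irr_step hn); lia.
have nm : csucc m = m.+1 by rewrite csuccE; first (case: eqP); lia.
have mu : m \notin u by apply/negP => /H; lia.
have pmu : cpred m \notin u.
  rewrite cpredE; last lia.
  case: eqP => m0; first by apply: u0; lia.
  by apply/negP => /H; lia.
have iw' : irr (u ++ [:: m]) := irr_cons iw.
case: (boolP (m.+1 \in u)) => [mS|nmS]; last first.
  by case: (@no_crossing n hn m h u'); rewrite -?cat_cons -?uE0 ?nm.
have [||u1 [u2 [uE m1 m2]]] := interlaced_once (q := m.+1) iu _ mS.
- by lia.
- by rewrite (@cpredE n m.+1) /= ?mu ?orbT //; lia.
have lt2 x : x \in u2 -> x.+1 < a.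
  move=> xu2; have /H [xm|//] : x \in u by rewrite uE mem_cat inE xu2 !orbT.
  have [s1 [s2 [E _]]] := split_first xu2.
  have sub z : z \in x :: s2 -> z \in u.
    by rewrite uE E mem_cat => zs; rewrite inE mem_cat zs !orbT.
  have nz z : z \notin u -> z \notin x :: s2 by apply: contra => /sub.
  case: (@no_crossing n hn m x s2 _ xm (nz _ mu) _ (nz _ pmu)).
    move: iw'; rewrite uE E -[m.+1 :: _]cat1s -!catA.
    by move=> /irr_catr/irr_catr/irr_catr.
  by rewrite nm; apply: contra m2; rewrite E mem_cat => ->; rewrite orbT.
case: (eqVneq m.+1 N) => [mN'|mN'].
  have u1E : u1 = [::].
    case: u1 uE m1 => [//|z u1]; rewrite uE0 => -[<- _].
    rewrite inE => /norP[hm1 _].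
    have : h < n by apply: (irr_ltn iw'); rewrite uE0 mem_head.
    lia.
  rewrite uE u1E /= m2 /=.
  move: (iw'); rewrite uE u1E mN' /=; case/lastP: u2 lt2 {uE m2} => // s z lt2.
  rewrite -cat_cons => /irr_catl iz.
  have sE : s = iota 0 z.
    apply: (ascent hn iz); apply/allP => x /lt2 /=; lia.
  by rewrite sE iota_rcons0 iota_uniq.
have u2E : u2 = [::].
  case: u2 lt2 uE {m2} => // z u2 lt2 uE; have := lt2 z (mem_head _ _).
  move: iw'; rewrite uE -catA /= => /irr_catr/(irr_step hn); lia.
move: uE; rewrite u2E => uE; rewrite uE cats1 rcons_uniq m1.
apply: (IH m.+1); try lia.
- by move: iw; rewrite uE -cat_cons; exact: irr_catl.
- by move: iu; rewrite uE; exact: interlaced_catl.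
- move=> x xu; have := H x; rewrite uE mem_cat xu => /(_ isT).
  have : x != m.+1 by apply: contraNneq m1 => <-.
  lia.
by move=> /u0; rewrite uE mem_cat => /norP[].
Qed.

(** Without [a - 1] in [u] the letters of [u] are distinct, so [a u a] is a
    left-hand side.  For [a = N] the word [u] is a climb from [0]. *)
Lemma cpred_between_repeats a u : irr (a :: u ++ [:: a]) -> interlaced u ->
  u != [::] -> a \notin u -> cpred a \in u.
Proof.
move=> iw iu u0 au; apply: contraT => pu.
have an : a < n := irr_ltn iw (mem_head _ _).
have un x : x \in u -> x < n.
  by move=> xu; apply: (irr_ltn iw); rewrite inE mem_cat xu !orbT.
have ne x y : y \notin u -> x \in u -> x != y by move=> yu xu; apply: contraNneq yu => <-.
suff uu : uniq u.
  case: (@irr_lhs n [::] (a :: u ++ [:: a]) [::]); first by rewrite cats0.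
  exact: LhsNoPred.
case: (eqVneq a N) => aN.
  move: iw au pu un ne u0; rewrite aN -cat_cons => /irr_catl.
  case/lastP: u {iu} => // s z iz au pu un ne _.
  have sE : s = iota 0 z.
    apply: (ascent hn iz); apply/allP => x xu /=.
    have := un x xu; have := ne _ _ au xu; have := ne _ _ pu xu.
    have -> : cpred N = N.-1 by rewrite cpredE; first (case: eqP); lia.
    lia.
  by rewrite sE iota_rcons0 iota_uniq.
apply: (uniq_before_descent _ iw iu); first by lia.
  move=> x xu; have := ne _ _ au xu; have := ne _ _ pu xu.
  by rewrite cpredE //; case: ifP; lia.
by move=> a0; move: pu; rewrite cpredE // a0.
Qed.

(** A word that stays below its first letter can only descend step by step: it
    cannot come back to [m - 1], since [m] would have to occur in between. *)
Lemma uniq_descending m t : m < N -> irr (m :: t) -> interlaced (m :: t) ->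
  {in t, forall x, x < m} -> uniq t.
Proof.
elim: t m => // h t IH m mN iw iu H /=.
have hm : m = h.+1.
  by have := H h (mem_head _ _); have := irr_step hn iw; lia.
have iu' : interlaced (h :: t) by case/andP: iu.
have ht : h \notin t.
  apply/negP => /split_first[s1 [s2 [E hs1]]].
  have := @interlaced_between n hn [::] h s1 s2; rewrite /= -E => /(_ iu' hs1).
  have nh : csucc h = m by rewrite csuccE; first (case: eqP); lia.
  rewrite nh; case/(_ _)/andP; first by lia.
  by move=> ms _; have := H m; rewrite E inE mem_cat ms !orbT => /(_ isT); lia.
rewrite ht (IH h) //; first by lia.
  exact: irr_cons iw.
move=> x xt; have := H x; rewrite inE xt orbT => /(_ isT).
have : x != h by apply: contraNneq ht => <-.
lia.
Qed.

(** A letter in front of the word either starts a new descent or raises the top of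
    the first one by one.  The raised top does not reach the top of the next
    descent, and a new descent starts below the bottom of the next one, because
    otherwise a letter would be repeated without its upper, respectively lower,
    neighbour in between. *)
Lemma descents_of s : irr s -> interlaced s -> s != [::] ->
  {in s, forall x, 0 < x < N} ->
  exists bs : seq (nat * nat), [/\ s = flatten [seq descent d.1 d.2 | d <- bs],
    bs != [::], all (fun d => d.2 <= d.1) bs,
    sorted ltn (rcons (map fst bs) N) & sorted ltn (rcons (map snd bs) N)].
Proof.
elim: s => // c s IH iw iu _ H.
have /andP[c0 cN] := H c (mem_head _ _).
case: (eqVneq s [::]) => [->|s0].
  by exists [:: (c, c)]; rewrite /= descent_id leqnn cN.
have iu' : interlaced s by case/andP: iu.
have [|[|[i j] bs] [sE // _ /= /andP[ji bji] si sj]] := IH (irr_cons iw) iu' s0.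
  by move=> x xs; apply: H; rewrite inE xs orbT.
rewrite /= in sE si sj.
have : i = c.-1 \/ c < i.
  have := iw; rewrite sE; case: i ji {sE si} => [|i] ji.
    by move: ji; rewrite leqn0 => /eqP->; rewrite descent_id /= => /(irr_step hn); lia.
  by rewrite descent_cons; [move=> /= /(irr_step hn); lia|lia].
have cn : c < n by lia.
case=> [ic|ci].
  exists ((c, j) :: bs); split=> //=.
  - have -> : c = i.+1 by lia.
    by rewrite sE descent_cons //; lia.
  - by rewrite bji; lia.
  case: bs sE bji {sj IH} si => [|[i2 j2] bs] /= sE; first by rewrite cN.
  move=> /andP[/descent_head[t tE] _] /andP[i2i ->]; rewrite andbT.
  case: (eqVneq c i2) => [ci2|]; last by lia.
  move: iu; rewrite sE tE -ci2 /= => /= iu.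
  have [] := andP (@interlaced_between n hn [::] c _ _ iu _ cn).
    by rewrite mem_descent; lia.
  by rewrite csuccE // mem_descent; case: eqP; lia.
exists ((c, c) :: (i, j) :: bs); split=> //=.
- by rewrite descent_id sE.
- by rewrite leqnn ji.
- by rewrite ci.
rewrite sj andbT ltnNge; apply/negP => jc.
move: iu; rewrite sE (@descent_cat i j c); try lia.
rewrite -(prednK c0) descent_cons; last by lia.
rewrite (prednK c0) -!catA => iu.
have [] := andP (@interlaced_between n hn [::] c _ _ iu _ cn).
  by rewrite mem_descent; lia.
by move=> _; rewrite mem_descent cpredE //; case: eqP; lia.
Qed.

(** Jumping from above [a + 1] to below [a] is the passage from [N] to [0]. *)
Lemma climb a y s z : irr (y :: rcons s z) -> a.+1 < y ->
  {in rcons s z, forall x, x < a} -> y = N /\ s = iota 0 z.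
Proof.
move=> iw ay H.
have yn : y < n := irr_ltn iw (mem_head _ _).
have yN : y = N.
  have := iw; have := H; case: (rcons s z) (size_rcons s z) => // b t _ Hb.
  by move/(irr_step hn); have := Hb b (mem_head _ _); lia.
split=> //; rewrite yN in iw; apply: (ascent hn iw).
by apply/allP => x /H /=; lia.
Qed.

(** The inner words with repeated letters and without [a + 1] end, together with
    the final [a], with the climb [N, 0, ..., a - 1, a].  What precedes stays
    strictly between [a + 1] and [N], hence is a product of descents. *)
Lemma no_repeat_after_climb a s : irr (a :: (s ++ N :: iota 0 a) ++ [:: a]) ->
  interlaced (s ++ N :: iota 0 a) -> a < N ->
  a \notin s ++ N :: iota 0 a -> csucc a \notin s ++ N :: iota 0 a ->
  cpred a \notin s -> False.
Proof.
move=> iw iv aN av nv ps.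
have nl : ~ lhs (a :: (s ++ N :: iota 0 a) ++ [:: a]).
  by apply: (@irr_lhs n [::] _ [::]); rewrite cats0.
have v0 : s ++ N :: iota 0 a != [::] by case: (s).
case: (eqVneq s [::]) => [s0|s0].
  apply: nl; apply: LhsNoSucc => //.
  by rewrite s0 /= iota_uniq mem_iota add0n -leqNgt (ltnW aN).
have nvE : csucc a = a.+1 by rewrite csuccE; first (case: eqP); lia.
have aN2 : a.+1 != N.
  by apply: contraNneq nv => e; rewrite nvE e mem_cat mem_head orbT.
have sn x : x \in s -> x < n.
  by move=> xs; apply: (irr_ltn iw); rewrite inE !mem_cat xs !orbT.
have ne x : x \in s -> [&& x != a, x != a.+1 & x != cpred a].
  move=> xs; apply/and3P; split; last by apply: contraNneq ps => <-.
    by apply: contraNneq av => <-; rewrite mem_cat xs.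
  by apply: contraNneq nv; rewrite nvE => <-; rewrite mem_cat xs.
(* a letter z < a of s starts a second climb 0, ..., z, and z would be repeated
   in the last climb without z + 1 in between *)
have gts : a != 0 -> {in s, forall x, a < x}.
  move=> a0 x xs; rewrite ltnNge; apply/negP => xa.
  have pE : cpred a = a.-1 by rewrite cpredE; first (case: eqP); lia.
  have [|r1 [z [r2 [sE /= za]]]] := @split_last _ (gtn a) s.
    by apply/hasP; exists x => //=; have := ne x xs; lia.
  rewrite -all_predC => /allP r2a.
  have zs : z \in s by rewrite sE mem_cat mem_head orbT.
  have z1a : z.+1 < a by have := ne z zs; lia.
  have [|q1 [y [q2 [r1E /= ya]]]] := @split_last _ (ltn a) r1.
    case: r1 sE => [|h r1] /= sE.
      by move: iw; rewrite sE /= => /(irr_step hn); lia.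
    have := ne h; rewrite sE mem_head => /(_ isT).
    by move: iw; rewrite sE /= => /(irr_step hn); lia.
  rewrite -all_predC => /allP q2a.
  have [|||yN q2E] := @climb a y q2 z.
  - apply: irr_infix iw; apply/infixP.
    exists (a :: q1), (r2 ++ N :: iota 0 a ++ [:: a]).
    by rewrite sE r1E -cats1 /= -!catA /= -?catA.
  - have := ne y; rewrite sE r1E mem_cat mem_cat mem_head orbT => /(_ isT); lia.
  - move=> b; rewrite mem_rcons inE => /orP[/eqP->|bq]; first lia.
    have := ne b; rewrite sE r1E !mem_cat inE bq !orbT => /(_ isT).
    by have := q2a b bq; rewrite /=; lia.
  have iE : iota 0 a = iota 0 z ++ z :: iota z.+1 (a - z.+1).
    have {1}-> : a = z + (a - z.+1).+1 by lia.
    by rewrite iotaD.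
  have zn : z < n by lia.
  move: iv; rewrite sE iE -!catA /=.
  rewrite (_ : r2 ++ _ = (r2 ++ N :: iota 0 z) ++ z :: iota z.+1 (a - z.+1));
    last by rewrite -catA.
  move/(interlaced_between hn) => /(_ _ zn)/andP; case.
    rewrite mem_cat inE mem_iota !negb_or; apply/and3P; split; try lia.
    by apply/negP => /r2a /=; lia.
  rewrite csuccE // mem_cat inE mem_iota => H _; move: H.
  case: eqP => [|_]; first lia.
  by case/orP => [/r2a /=|]; lia.
(* two letters N would need a letter 0 in between *)
have Ns : N \notin s.
  apply/negP => NIs; case: (eqVneq a 0) => [a0|a0].
    by move: ps; rewrite cpredE ?a0 ?NIs //; lia.
  have [|r1 [z [r2 [sE /= /eqP zN]]]] := @split_last _ (pred1 N) s.
    by rewrite has_pred1.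
  rewrite has_pred1 zN in sE * => Nr.
  move: iv; rewrite sE -catA /= => /(interlaced_between hn) => /(_ Nr) H.
  have /H/andP[r0 _] : N < n by lia.
  have := gts a0 0; rewrite sE mem_cat inE (_ : 0 \in r2) ?orbT //.
    by move/(_ isT); lia.
  by move: r0; rewrite csuccE; first (case: eqP => //); lia.
have [||//|x xs|bs [sE bs0 bsd b1 b2]] := @descents_of s.
- by move: iw; rewrite -cat_cons -cat1s -!catA => /irr_catr/irr_catl.
- exact: interlaced_catl iv.
- have := ne x xs; have : x != N by apply: contraNneq Ns => <-.
  have := sn x xs; case: (eqVneq a 0) => [->|a0]; first lia.
  by have := gts a0 x xs; lia.
by apply: nl; apply: (@LhsNoSuccRuns n a _ bs) => //; rewrite -sE.
Qed.

(** The letter [a - 1] occurs exactly once in [v], by [no_crossing] and because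
    its upper neighbour [a] is absent.  If [v] starts with it, [v] descends from
    there.  Otherwise [v] starts above [a], and reaches [a - 1] by a climb
    from [0]; after that climb nothing can follow, since a step down would create
    a valley. *)
Lemma csucc_between_repeats a v : irr (a :: v ++ [:: a]) -> interlaced v ->
  v != [::] -> a \notin v -> csucc a \in v.
Proof.
move=> iw iv v0 av; apply: contraT => nv.
have nl : ~ lhs (a :: v ++ [:: a]).
  by apply: (@irr_lhs n [::] _ [::]); rewrite cats0.
have nu : ~~ uniq v by apply/negP => uv; apply: nl; exact: LhsNoSucc.
have an : a < n := irr_ltn iw (mem_head _ _).
have vn x : x \in v -> x < n.
  by move=> xv; apply: (irr_ltn iw); rewrite inE mem_cat xv !orbT.
have ne x y : y \notin v -> x \in v -> x != y by move=> yv xv; apply: contraNneq yv => <-.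
have iv' : irr v by apply: irr_catl (irr_cons iw).
have [nE pE] := (csuccE an, cpredE an).
have hd h t : v = h :: t -> h != cpred a -> a < h.
  move=> vE; have hv : h \in v by rewrite vE mem_head.
  have := ne _ _ av hv; have := ne _ _ nv hv; rewrite nE pE.
  have := iw; rewrite vE => /(irr_step hn).
  by case: ifP; case: ifP; lia.
case: (boolP (cpred a \in v)) => [pv|pv]; last first.
  case vE: v v0 => [//|h t] _; exfalso.
  apply: (@no_crossing n hn a h t); rewrite -?cat_cons -?vE //.
    exact: irr_cons iw.
  by apply: (hd h t) => //; apply: ne => //; rewrite vE mem_head.
have pn : cpred a < n := vn _ pv.
have npE : csucc (cpred a) = a.
  by rewrite csuccE // pE; case: (eqVneq a 0) => ?; case: eqP; lia.
have [|v1 [v2 [vE p1 p2]]] := interlaced_once iv pn pv; first by rewrite npE av.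
have lt2 : a < N -> {in v2, forall x, x < a}.
  move=> aN x xv; have xv' : x \in v by rewrite vE mem_cat inE xv !orbT.
  have := ne _ _ av xv'; case: ltngtP => // ax _.
  have [s1 [s2 [E _]]] := split_first xv.
  have nz z : z \notin v -> z \notin x :: s2.
    by apply: contra => zs; rewrite vE E mem_cat in_cons mem_cat zs !orbT.
  exfalso; apply: (@no_crossing n hn a x s2 _ ax (nz _ av) (nz _ nv)).
    apply: irr_infix iw; apply/infixP; exists (a :: v1 ++ cpred a :: s1), [::].
    by rewrite vE E cats0 /= -!catA /= -?catA.
  by apply: contra p2; rewrite E mem_cat => ->; rewrite orbT.
have downhill : v1 = [::] -> a != 0 -> uniq v.
  move=> v10 a0; move: vE; rewrite v10 /= => vE.
  rewrite vE /= p2; apply: (@uniq_descending (cpred a)); rewrite -?vE //.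
    by rewrite pE; case: ifP; lia.
  move=> x xv; have xv' : x \in v by rewrite vE inE xv !orbT.
  have : x != cpred a by apply: contraNneq p2 => <-.
  have := vn x xv'; have := ne _ _ av xv'; rewrite pE (negbTE a0).
  by case: (ltnP a N) => [/lt2/(_ x xv)|]; lia.
case: (eqVneq a N) => [aN|aN].
  case: v1 vE p1 downhill => [|h t] vE p1 downhill.
    by case/negP: nu; apply: downhill => //; lia.
  exfalso; have hp : h != cpred a by move: p1; rewrite inE eq_sym => /norP[].
  have := hd _ _ vE hp; have : h < n by apply: vn; rewrite vE mem_head.
  lia.
have {}aN : a < N by lia.
have {}lt2 := lt2 aN.
case: (eqVneq a 0) => [a0|a0].
  have v20 : v2 = [::] by case: v2 lt2 {vE p2} => // z v2 /(_ z (mem_head _ _)); lia.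
  have vE' : v = v1 ++ N :: iota 0 a.
    by rewrite vE v20 pE a0.
  by exfalso; apply: (@no_repeat_after_climb a v1); rewrite -?vE'.
case: v1 vE p1 downhill => [|h t] vE p1 downhill.
  by case/negP: nu; apply: downhill.
have hp : h != cpred a by move: p1; rewrite inE eq_sym => /norP[].
have ah := hd _ _ vE hp.
have [|s1 [y [s2 [v1E /= ya]]]] := @split_last _ (ltn a) (h :: t).
  by rewrite /= ah.
rewrite -all_predC => /allP s2a; rewrite v1E in vE p1.
have [yv s2v] : y \in v /\ {subset s2 <= v}.
  rewrite vE !mem_cat mem_head orbT; split=> // x xs.
  by rewrite !mem_cat inE xs !orbT.
have pE' : cpred a = a.-1 by rewrite pE (negbTE a0).
have [|||yN s2E] := @climb a y s2 (cpred a).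
- move: iv'; rewrite vE -cats1 -[cpred a :: v2]cat1s -[y :: s2]cat1s -!catA.
  by move/irr_catr; rewrite !catA => /irr_catl.
- have := ne _ _ nv yv; have := vn _ yv; rewrite nE; case: ifP; lia.
- move=> x; rewrite mem_rcons inE => /orP[/eqP->|xs]; first lia.
  by have := s2a x xs; have := ne _ _ av (s2v _ xs); rewrite /=; lia.
have v2E : v2 = [::].
  case: v2 vE p2 lt2 => // z v2 vE p2 lt2; exfalso.
  have za := lt2 z (mem_head _ _).
  have zp : cpred a != z by move: p2; rewrite inE => /norP[].
  have pz : cpred a = z.+1.
    move: iv'; rewrite vE => /irr_catr/(irr_step hn); lia.
  move: iv'; rewrite vE s2E pz -iota_rcons0 -cats1.
  rewrite -[y :: _]cat1s -!catA; do 3 move/irr_catr.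
  by apply: no_valley => //; lia.
have vE' : v = s1 ++ N :: iota 0 a.
  by rewrite vE v2E s2E yN -catA /= cats1 iota_rcons0 pE' prednK // lt0n.
exfalso; apply: (@no_repeat_after_climb a s1); rewrite -?vE' //.
by apply: contra p1 => ps; rewrite mem_cat ps.
Qed.

(** By induction the tail of the word is interlaced, in particular what lies
    between its first letter and the next occurrence of that letter. *)
Theorem irr_interlaced w : irr w -> interlaced w.
Proof.
elim: w => //= a u IH iw; have iu := IH (irr_cons iw); rewrite iu /=.
apply/implyP => /split_first[u1 [y [uE au]]].
rewrite uE in iw iu *.
have iu1 := interlaced_catl iu.
have iw1 : irr (a :: u1 ++ [:: a]).
  by move: iw; rewrite -[a :: y]cat1s catA -cat_cons; exact: irr_catl.
have u0 : u1 != [::].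
  apply/eqP => u0; rewrite u0 in iw1; case: (@irr_lhs n [::] [:: a; a] [::] iw1).
  exact: LhsIdem.
rewrite !index_cat (negbTE au) /= eqxx addn0.
have pu := cpred_between_repeats iw1 iu1 u0 au.
have nu := csucc_between_repeats iw1 iu1 u0 au.
by rewrite pu nu !index_mem pu nu.
Qed.

End Interlacing.

(** * Congruent irreducible words are equal *)

Section Words.
Context (n : nat).
Context (hn : 2 < n).
Implicit Types (i j : 'I_n) (r s t u v w : seq 'I_n).
Local Notation N := n.-1.

Lemma val_ordS i : val (ordS i) = csucc n i.
Proof. by []. Qed.

Lemma val_ord_pred i : val (ord_pred i) = cpred n i.
Proof. by rewrite /= /cpred; congr (_ %% _); lia. Qed.

Lemma n_gt0 : 0 < n. Proof. lia. Qed.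

Definition to_ord (x : nat) : 'I_n := insubd (Ordinal n_gt0) x.

Lemma to_ordK x : x < n -> to_ord x = x :> nat.
Proof. by rewrite /to_ord val_insubd => ->. Qed.

Lemma val_to_ordK x : x < n -> val (to_ord x) = x.
Proof. exact: to_ordK. Qed.

Lemma map_to_ordK (s : seq nat) : all (gtn n) s ->
  [seq val i | i <- map to_ord s] = s.
Proof.
by elim: s => //= x s IH /andP[xn /IH ->]; rewrite to_ordK.
Qed.

Lemma mem_val i s : (val i \in map val s) = (i \in s).
Proof. exact: mem_map val_inj _ _. Qed.

Lemma val_run_up i j : i <= j -> map val (run i j) = iota i (j.+1 - i).
Proof.
rewrite /run => ->; apply: (irr_sorted_eq ltn_trans ltnn).
- rewrite sorted_map; apply: sorted_filter; first by move=> ? ? ?; exact: ltn_trans.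
  by rewrite -sorted_map val_enum_ord iota_ltn_sorted.
- exact: iota_ltn_sorted.
move=> x; rewrite mem_iota; apply/mapP/idP => [[l]|xj].
  by rewrite mem_filter => /andP[lj _] ->; move: lj => /=; lia.
have xn : x < n by have := ltn_ord j; lia.
by exists (Ordinal xn) => //; rewrite mem_filter mem_enum andbT /=; lia.
Qed.

Lemma val_run_down i j : j <= i -> map val (run i j) = descent i j.
Proof.
rewrite leq_eqVlt => /orP[/eqP ij|ji].
  by rewrite val_run_up ij // subSnn descent_id.
have -> : run i j = rev (run j i) by rewrite /run leqNgt ji (ltnW ji).
by rewrite map_rev val_run_up // ltnW.
Qed.

Lemma count_mem_eq0 i s : (count_mem i s == 0) = (val i \notin map val s).
Proof. by rewrite mem_val -has_pred1 has_count lt0n negbK. Qed.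

Lemma no_arrow_toE s i :
  no_arrow_to s i = (val i \notin map val s) && (cpred n i \notin map val s).
Proof. by rewrite /no_arrow_to !count_mem_eq0 val_ord_pred. Qed.

Lemma no_arrow_fromE s i :
  no_arrow_from i s = (val i \notin map val s) && (csucc n i \notin map val s).
Proof. by rewrite /no_arrow_from !count_mem_eq0. Qed.

Lemma uniq_count_le1 s j : uniq (map val s) -> count_mem j s <= 1.
Proof.
by rewrite (map_inj_uniq val_inj) => /count_uniq_mem ->; case: (_ \in _).
Qed.

Lemma map_val_inj s t : map val s = map val t -> s = t.
Proof. exact: inj_map val_inj _ _. Qed.

Lemma map_val_to_ord s : map to_ord (map val s) = s.
Proof.
by apply: map_val_inj; rewrite map_to_ordK //; apply/allP => _ /mapP[i _ ->] /=.
Qed.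

(** Irreducibility was studied for words of natural numbers; each left-hand side
    found there is the left-hand side of an actual rule. *)
Lemma lhs_redS' (r : seq nat) : lhs n r -> all (gtn n) r ->
  exists q, redS' n (map to_ord r, q).
Proof.
have K (s : seq nat) : all (gtn n) s -> map val (map to_ord s) = s by exact: map_to_ordK.
case=> {r} [i|i j|i j|i u|i v|i v bs].
- by move=> _; eexists; apply/S'123/Red1.
- move=> ij /= /and3P[jn In _]; eexists; apply/S'123/Red2.
  by rewrite !to_ordK; lia.
- move=> ij jN _; eexists; apply/S'123.
  have E : map to_ord (N :: iota 0 i.+1 ++ [:: j]) =
      to_ord N :: run (to_ord 0) (to_ord i) ++ [:: to_ord j].
    apply: map_val_inj; rewrite K; last first.
      rewrite /= all_cat /= andbT; apply/and4P; split; try lia.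
      by apply/allP => x; rewrite mem_iota /=; lia.
    rewrite map_cons map_cat val_run_up /= ?to_ordK //; lia.
  rewrite E; apply: Red3; rewrite ?to_ordK; lia.
- move=> u0 iu pu uu /= /andP[In]; rewrite all_cat => /andP[un _].
  exists (to_ord i :: map to_ord u); rewrite map_cat.
  have uu' : uniq (map val (map to_ord u)) by rewrite K.
  apply: S'4 => //; last by move=> j _ _; exact: uniq_count_le1.
    by case: (u) u0.
  by rewrite no_arrow_toE K // val_to_ordK // to_ordK // iu.
- move=> v0 iv nv uv /= /andP[In]; rewrite all_cat => /andP[vn _].
  exists (map to_ord v ++ [:: to_ord i]); rewrite map_cat.
  have uv' : uniq (map val (map to_ord v)) by rewrite K.
  apply: S'5 => //; last by move=> j _ _; exact: uniq_count_le1.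
    by case: (v) v0.
  by rewrite no_arrow_fromE K // val_to_ordK // to_ordK // iv.
move=> v0 iv nv iN bs0 bsd b1 b2 vE /= /andP[In]; rewrite all_cat => /andP[vn _].
exists (map to_ord v ++ [:: to_ord i]); rewrite map_cat.
have bn d : d \in bs -> d.2 <= d.1 < n.
  move=> db; have le := allP bsd _ db; rewrite le /=.
  apply: (allP vn); rewrite vE mem_cat; apply/orP; left.
  by apply/flatten_mapP; exists d => //; rewrite mem_descent le leqnn.
pose bs' := [seq (to_ord d.1, to_ord d.2) | d <- bs].
have srt (f : nat * nat -> nat) (g : 'I_n * 'I_n -> nat) :
    (forall d, d \in bs -> g (to_ord d.1, to_ord d.2) = (f d).+1) ->
    sorted ltn (rcons (map f bs) N) -> sorted ltn (rcons (map g bs') n).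
  move=> fg; rewrite /bs' -map_comp.
  have -> : rcons [seq (g \o (fun d => (to_ord d.1, to_ord d.2))) d | d <- bs] n =
      map succn (rcons (map f bs) N).
    rewrite map_rcons -map_comp; congr rcons; last by lia.
    by apply/eq_in_map => d /fg.
  by rewrite sorted_map; apply: sub_sorted => x y.
apply: (@S'5run n (to_ord 0) (to_ord N) (to_ord i) (map to_ord v) bs').
- by rewrite to_ordK; lia.
- by rewrite to_ordK; lia.
- by case: (v) v0.
- by rewrite no_arrow_fromE K // val_to_ordK // to_ordK // iv.
- by rewrite to_ordK //; lia.
- by rewrite size_map; case: (bs) bs0.
- apply: srt b1 => d /bn /andP[_ dn]; congr _.+1; exact: to_ordK.
- apply: srt b2 => d /bn /andP[dd dn]; congr _.+1.
  by apply: to_ordK; exact: leq_ltn_trans dn.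
apply: map_val_inj; rewrite /= !map_cat K //= val_run_up ?to_ordK; try lia.
congr (_ :: _); rewrite vE subn0 -iota_rcons0 -cats1 -catA /=.
congr (_ ++ _); rewrite map_flatten -!map_comp; congr flatten.
apply/eq_in_map => d /bn /andP[le lt]; have lt2 := leq_ltn_trans le lt.
by rewrite /= val_run_down !to_ordK.
Qed.

Lemma irr_of_reduced (w : F n) : reduced (redS' n) w -> irr n (map val (w : seq 'I_n)).
Proof.
move=> rw; split; first by apply/allP => _ /mapP[i _ ->] /=.
move=> r lr; apply/negP => /infixP[s [t E]].
have rn : all (gtn n) r.
  apply/allP => x xr; have : x \in map val (w : seq 'I_n) by rewrite E !mem_cat xr orbT.
  by case/mapP => i _ -> /=.
have [q /rw/negP] := lhs_redS' lr rn; apply.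
by rewrite -[X in infix _ X](map_val_to_ord w) E !map_cat infix_infix.
Qed.

Lemma walk_cong (u v : F n) : hk_cong u v ->
  walk n (map val (u : seq 'I_n)) =1 walk n (map val (v : seq 'I_n)).
Proof.
elim=> {u v} [u v uv p|//|u v _ IH p|u v w _ IH1 _ IH2 p|u v u' v' _ IH1 _ IH2 p].
- case: uv => [i|i|i|i j ij]; rewrite /= -?[_ %% n]/(csucc n i).
  + exact: walk_idem.
  + by case: (walk_braid hn p (ltn_ord i)).
  + by case: (walk_braid hn p (ltn_ord i)).
  have := ltn_ord i; have := ltn_ord j => jn In.
  by apply: walk_comm => //; try (rewrite csuccE //; case: ifP); lia.
- by rewrite IH.
- by rewrite IH1 IH2.
by rewrite !fmM !map_cat /walk !foldl_cat -!/(walk _ _ _) IH1 IH2.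
Qed.

Lemma reduced_cong (u v : F n) : reduced (redS' n) u -> reduced (redS' n) v ->
  hk_cong u v -> u = v.
Proof.
move=> /irr_of_reduced iu /irr_of_reduced iv /walk_cong E.
apply/eqP; rewrite fmP; apply/eqP/map_val_inj.
exact: (walk_inj hn iu iv (irr_interlaced hn iu) (irr_interlaced hn iv) E).
Qed.

End Words.

(** * The rules hold in the monoid and lower the deg-lex order *)

Section Soundness.
Context (n : nat).
Context (hn : 2 < n).
Implicit Types (i j : 'I_n) (r s t u v w : seq 'I_n).
Local Notation "u ~~ v" := (hk_cong (FMonom u) (FMonom v)) (at level 70).

Lemma mmul_cat u v : mmul (FMonom u : F n) (FMonom v) = FMonom (u ++ v).
Proof. by apply/eqP; rewrite fmP fmM. Qed.

Lemma cong_cat u v u' v' : u ~~ v -> u' ~~ v' -> u ++ u' ~~ v ++ v'.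
Proof. by move=> H H'; rewrite -!mmul_cat; exact: HKmul. Qed.

Lemma cong_in s u v t : u ~~ v -> s ++ u ++ t ~~ s ++ v ++ t.
Proof. by move=> H; do ![exact: HKrefl | exact: H | apply: cong_cat]. Qed.

Lemma cong_comm i j : j != i -> j != ordS i -> j != ord_pred i ->
  [:: i; j] ~~ [:: j; i].
Proof.
rewrite -!val_eqE [val (ord_pred i)]val_ord_pred // val_ordS.
rewrite csuccE // cpredE //; move: (ltn_ord i) (ltn_ord j) => /= In jn ji jS jP.
case: (ltnP j i) => ij.
  by apply/HKrel/HKcomm; move: jS jP; case: ifP; case: ifP; lia.
by apply/HKsym/HKrel/HKcomm; move: jS jP; case: ifP; case: ifP; lia.
Qed.

(** The final [i] moves to the left through the letters of [u] that commute with
    it.  When it meets [i + 1], the copy of [i] in front, which can be duplicated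
    next to this letter by induction, absorbs it by the braid relation. *)
Lemma cong_absorb_left i u : no_arrow_to u i -> i :: u ++ [:: i] ~~ i :: u.
Proof.
elim/last_ind: u => [|u c IH]; first by move=> _; apply/HKrel/HKidem.
rewrite /no_arrow_to -!cats1 !count_cat !addn_eq0 /= !eqb0 !andbT.
move=> /andP[/andP[u1 ci] /andP[u2 cp]].
have {u1 u2} IHu := IH (introT andP (conj u1 u2)).
have sub : (i :: u) ++ [:: i; c] ~~ (i :: u) ++ [:: c].
  by have := cong_cat IHu (HKrefl (FMonom [:: c])); rewrite /= -catA.
rewrite -catA; change (i :: u ++ [:: c] ++ [:: i]) with ((i :: u) ++ [:: c; i]).
change (i :: u ++ [:: c]) with ((i :: u) ++ [:: c]).
apply: HKtrans (sub); case: (eqVneq c (ordS i)) => [cS|cS]; last first.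
  by apply: cong_cat; [exact: HKrefl|apply: HKsym; apply: cong_comm].
rewrite {}cS in sub *; set b := ordS i in sub *.
apply: (HKtrans (v := FMonom ((i :: u) ++ [:: i; b; i]))).
  by apply: HKsym; have := cong_cat sub (HKrefl (FMonom [:: i])); rewrite -!catA.
by apply: cong_cat; [exact: HKrefl|apply/HKrel/HKbraidl].
Qed.

(** Dually, the initial [i] moves to the right and is absorbed by each [i - 1],
    thanks to the copy of [i] at the end. *)
Lemma cong_absorb_right i v : no_arrow_from i v -> i :: v ++ [:: i] ~~ v ++ [:: i].
Proof.
elim: v => [|c v IH]; first by move=> _; apply/HKrel/HKidem.
rewrite /no_arrow_from /= !addn_eq0 !eqb0.
move=> /andP[/andP[ci v1] /andP[cS v2]].
have {v1 v2} IHv := IH (introT andP (conj v1 v2)).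
have sub : [:: c; i] ++ v ++ [:: i] ~~ [:: c] ++ v ++ [:: i].
  by apply: (cong_cat (u := [:: c]) (v := [:: c])); [exact: HKrefl|exact: IHv].
change ([:: i; c] ++ v ++ [:: i] ~~ [:: c] ++ v ++ [:: i]).
apply: HKtrans (sub); case: (eqVneq i (ordS c)) => [iS|iS]; last first.
  apply: cong_cat; [|exact: HKrefl]; apply: HKsym; apply: cong_comm => //.
    by rewrite eq_sym.
  by apply: contra cS => /eqP->; rewrite ord_predK.
apply: (HKtrans (v := FMonom ([:: i; c; i] ++ v ++ [:: i]))).
  apply: HKsym; apply: (cong_cat (u := [:: i]) (v := [:: i])) => //.
  exact: HKrefl.
apply: cong_cat; [|exact: HKrefl].
by rewrite iS; exact: HKrel (HKbraidr c).
Qed.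

Lemma cong_commute j s : {in s, forall i, [/\ j != i, j != ordS i & j != ord_pred i]} ->
  s ++ [:: j] ~~ j :: s.
Proof.
elim: s => [|i s IH] H; first exact: HKrefl.
have {}IH : s ++ [:: j] ~~ j :: s.
  by apply: IH => x xs; apply: H; rewrite inE xs orbT.
have [j1 j2 j3] := H i (mem_head _ _).
apply: (HKtrans (v := FMonom ([:: i; j] ++ s))).
  by apply: (cong_cat (u := [:: i]) (v := [:: i])); [exact: HKrefl|].
by apply: (cong_cat (u := [:: i; j]) (v := [:: j; i])); [exact: cong_comm|exact: HKrefl].
Qed.

Lemma redS_cong p : redS n p -> p.1 ~~ p.2.
Proof.
case=> {p} [_ [i|i j ij|x1 xn i j x10 xnn ij]
  |i u _ /cong_absorb_left //|i v _ /cong_absorb_right //].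
- exact: HKrel (HKidem i).
- exact: HKrel (HKcomm ij).
apply: (@cong_commute j (xn :: run x1 i)) => l li.
have lb : (l == xn) || (l <= i).
  move: li; rewrite inE => /orP[->//|].
  by rewrite -mem_val val_run_up ?x10 // mem_iota /=; lia.
move: lb; rewrite -!val_eqE [val (ord_pred l)]val_ord_pred // val_ordS /=.
rewrite csuccE // cpredE //; move: (ltn_ord j) (ltn_ord l) => *.
by split; try case: ifP; lia.
Qed.

Lemma redS'_redS p : redS' n p -> redS n p.
Proof.
case=> {p} [p|i u u0 ui _|i v v0 vi _|x1 xn i z bs _ _ z0 iz _ _ _ _ _].
- exact: S123.
- exact: S4.
- exact: S5.
exact: S5.
Qed.

Fixpoint digits s := if s is i :: t then i * n ^ size t + digits t else 0.

(** Deg-lex is the usual order of integers once a word is read in base [n]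
    behind a leading digit [1]. *)
Definition code s := n ^ size s + digits s.

Lemma digits_lt s : digits s < n ^ size s.
Proof.
elim: s => //= i s IH; rewrite expnS.
have : i * n ^ size s + n ^ size s <= n * n ^ size s.
  by rewrite -mulSnr leq_mul2r ltn_ord orbT.
lia.
Qed.

Lemma digits_cat s t : digits (s ++ t) = digits s * n ^ size t + digits t.
Proof.
elim: s => //= i s ->; rewrite size_cat expnD.
by rewrite mulnDl mulnA addnA.
Qed.

Lemma code_ltn_size s t : size s < size t -> code s < code t.
Proof.
move=> st; rewrite /code; have := digits_lt s.
have : n ^ (size s).+1 <= n ^ size t by rewrite leq_pexp2l //; lia.
rewrite expnS; have : 2 * n ^ size s <= n * n ^ size s by rewrite leq_mul2r; lia.
lia.
Qed.

Lemma lexi_digits s t : size s = size t ->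
  ((s : seqlexi 'I_n) <= (t : seqlexi 'I_n))%O = (digits s <= digits t).
Proof.
elim: s t => [|i s IH] [|j t] //= [st].
rewrite Order.SeqLexiOrder.lexi_cons IH // !leEord st.
have := digits_lt s; have := digits_lt t; rewrite st.
case: (ltngtP i j) => ij /=.
- have : i.+1 * n ^ size t <= j * n ^ size t by rewrite leq_mul2r ij orbT.
  rewrite mulSn; lia.
- have : j.+1 * n ^ size t <= i * n ^ size t by rewrite leq_mul2r ij orbT.
  rewrite mulSn; lia.
by rewrite ij leq_add2l.
Qed.

Lemma deglexE (u v : F n) : deglex u v = (code u <= code v).
Proof.
rewrite /deglex; case: (ltngtP (size u) (size v)) => [uv|vu|uv] /=.
- by rewrite ltnW // code_ltn_size.
- by apply/esym/negbTE; rewrite -ltnNge code_ltn_size.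
by rewrite lexi_digits // /code uv leq_add2l.
Qed.

Lemma code_inj : injective code.
Proof.
move=> s t e.
have st : size s = size t.
  by case: (ltngtP (size s) (size t)) => // /code_ltn_size; rewrite e ltnn.
have d : digits s = digits t by move: e; rewrite /code st; lia.
by apply/(@Order.le_anti _ (seqlexi 'I_n)); rewrite !lexi_digits // d leqnn.
Qed.

Lemma code_in r s t w : code s < code t -> code (r ++ s ++ w) < code (r ++ t ++ w).
Proof.
move=> st; case: (ltngtP (size s) (size t)) => [lt|lt|e].
- by apply: code_ltn_size; rewrite !size_cat; lia.
- by have := code_ltn_size lt; lia.
move: st; rewrite /code !digits_cat !size_cat e !ltn_add2l => st.
by rewrite ltn_add2r ltn_mul2r expn_gt0; lia.
Qed.

Lemma code_cons_lt i j s t : size s = size t -> i < j -> code (i :: s) < code (j :: t).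
Proof.
move=> st ij; rewrite /code /= st ltn_add2l.
have := digits_lt s; rewrite st.
have : i.+1 * n ^ size t <= j * n ^ size t by rewrite leq_mul2r ij orbT.
rewrite mulSn; lia.
Qed.

Lemma redS_code p : redS n p -> code p.2 < code p.1.
Proof.
case=> {p} [_ [i|i j ij|x1 xn i j x10 xnn ij]|i u _ _|i v _ _].
- exact: code_ltn_size.
- by apply: code_cons_lt => //; lia.
- by apply: code_cons_lt; [rewrite size_cat /=; lia|lia].
- by apply: code_ltn_size; rewrite /= size_cat /=; lia.
by apply: code_ltn_size; rewrite /= size_cat /=; lia.
Qed.

End Soundness.

(** * Normal forms and leading monomials *)

Import GRing.Theory.
Local Open Scope quotient_scope.
Local Open Scope classical_set_scope.
Local Open Scope ring_scope.

Section Ideals.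
Context (R : nzRingType) (G : set R).

Lemma ideal_genW f : G f -> ideal_gen G f.
Proof. by move=> Gf I _; apply. Qed.

Lemma ideal_gen_ideal : two_sided_ideal (ideal_gen G).
Proof.
split=> [I [I0 _ _] _ //|f g fG gG I iI GI|a f fG].
  by case: (iI) => _ ID _; apply: ID; [exact: fG|exact: gG].
by split=> I iI GI; case: (iI) => _ _ /(_ a f (fG I iI GI)) [].
Qed.

Lemma ideal_sum (I : set R) (T : eqType) (s : seq T) (F : T -> R) :
  two_sided_ideal I -> (forall x, x \in s -> I (F x)) -> I (\sum_(x <- s) F x).
Proof.
move=> [I0 ID _] H; rewrite big_seq; elim/big_ind: _ => //.
Qed.
End Ideals.

Section MonoidAlgebra.
Context (R : nzRingType) (K : choiceType).

Lemma scale_malgU (c : R) (x : K) : c *: << x >> = << c *g x >> :> {malg R[K]}.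
Proof. by apply/malgP => y; rewrite mcoeffZ !mcoeffU mulrnAr mulr1. Qed.

Lemma mcoeff_sumU (T : Type) (s : seq T) (c : T -> R) (h : T -> K) y :
  (\sum_(x <- s) << c x *g h x >>)@_y = \sum_(x <- s) c x *+ (h x == y).
Proof. by rewrite raddf_sum; apply: eq_bigr => x _; rewrite /= mcoeffU. Qed.

Lemma mcoeff_sum_id (f : {malg R[K]}) y :
  \sum_(x <- msupp f) f@_x *+ (x == y) = f@_y.
Proof. by rewrite [in RHS](monalgE f) mcoeff_sumU. Qed.
End MonoidAlgebra.

Section MonoidAlgebraMul.
Context (R : nzRingType) (K : monomType).

Lemma mulUU (c d : R) (x y : K) :
  << c *g x >> * << d *g y >> = << c * d *g mmul x y >> :> {malg R[K]}.
Proof. by rewrite malgM_def fgmulUU. Qed.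

Lemma mulUBU (s x y t : K) :
  << s >> * (<< x >> - << y >>) * << t >> =
  << mmul (mmul s x) t >> - << mmul (mmul s y) t >> :> {malg R[K]}.
Proof. by rewrite mulrBr mulrBl !mulUU !mulr1. Qed.

Lemma mulCB (c : R) (x y : K) :
  c%:MP * (<< x >> - << y >>) = << c *g x >> - << c *g y >> :> {malg R[K]}.
Proof. by rewrite mul_malgC scalerBr !scale_malgU. Qed.
End MonoidAlgebraMul.

Section Algebra.
Context (n : nat) (k : fieldType).
Context (hn : (2 < n)%N).
Local Notation A := {malg k[F n]}.
Implicit Types (f g : A) (u v w : F n).

Lemma nat_homU (c : k) w : nat_hom (<< c *g w >> : A) = << c *g \pi_(C n) w >>.
Proof.
by rewrite /nat_hom mmapU mul_malgC; exact: scale_malgU.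
Qed.

Lemma nat_hom_sum (T : Type) (s : seq T) (G : T -> A) :
  nat_hom (\sum_(x <- s) G x) = \sum_(x <- s) nat_hom (G x).
Proof. by rewrite /nat_hom raddf_sum. Qed.

Lemma nat_homE f : nat_hom f = \sum_(w <- msupp f) << f@_w *g \pi_(C n) w >>.
Proof.
by rewrite {1}[f]monalgE nat_hom_sum; apply: eq_bigr => w _; rewrite nat_homU.
Qed.

Lemma nat_homZ f : nat_hom f = \sum_(w <- msupp f) f@_w *: word_img k w.
Proof. by rewrite /nat_hom mmapE; apply: eq_bigr => w _; rewrite mul_malgC. Qed.

Lemma nat_homM f g : nat_hom (f * g) = nat_hom f * nat_hom g.
Proof.
rewrite malgME nat_hom_sum !nat_homE mulr_suml; apply: eq_bigr => u _.
rewrite nat_hom_sum mulr_sumr; apply: eq_bigr => v _.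
by rewrite nat_homU mulUU -Cmul_pi.
Qed.

Lemma JE f : J k n f <-> nat_hom f = 0.
Proof. exact: iff_refl. Qed.

Lemma nat_hom0 : nat_hom (0 : A) = 0.
Proof. exact: raddf0. Qed.

Lemma nat_homD f g : nat_hom (f + g) = nat_hom f + nat_hom g.
Proof. exact: raddfD. Qed.

Lemma nat_homB f g : nat_hom (f - g) = nat_hom f - nat_hom g.
Proof. exact: raddfB. Qed.

Lemma J_ideal : two_sided_ideal (J k n).
Proof.
split=> [|f g /JE fJ /JE gJ|a f /JE fJ]; first exact/JE/nat_hom0.
  by apply/JE; rewrite nat_homD fJ gJ addr0.
split; apply/JE; rewrite nat_homM fJ; [exact: mulr0|exact: mul0r].
Qed.

(** Serves both for combinations of irreducible words and for an irreducible
    leading word. *)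
Lemma nat_hom_coef f w :
  (forall u, u \in msupp f -> hk_cong u w -> u = w) ->
  (nat_hom f)@_(\pi_(C n) w) = f@_w.
Proof.
move=> H; rewrite nat_homE mcoeff_sumU -[in RHS](mcoeff_sum_id f) !big_seq.
apply: eq_bigr => u uf; congr (_ *+ nat_of_bool _).
by apply/eqP/eqP => [/C_eqP|->//]; exact: H.
Qed.

(** Each rewriting step changes the word by an element of the ideal and lowers
    [code]. *)
Lemma normal_form_exists w : exists w0, [/\ reduced (redS' n) w0, hk_cong w w0,
  (code w0 <= code w)%N &
  ideal_gen (binomials k (redS' n)) (<< w >> - << w0 >>)].
Proof.
have [m] := ubnP (code w); elim: m w => // m IH w wm.
have [iG0 iGD iGM] := ideal_gen_ideal (binomials k (redS' n)).
case: (EM (reduced (redS' n) w)) => [rw|nr].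
  by exists w; split=> //; [exact: HKrefl|rewrite subrr; exact: iG0].
have [p [Sp /infixP[s [t wE]]]] : exists p, redS' n p /\ infix p.1 w.
  apply: contrapT => H; apply: nr => p Sp; apply/negP => pw.
  by apply: H; exists p.
have {wE} wE : w = FMonom (s ++ p.1 ++ t) by apply/eqP; rewrite fmP wE.
pose w1 : F n := FMonom (s ++ p.2 ++ t).
have Sp' := redS'_redS Sp.
have lt : (code w1 < code w)%N by rewrite wE; apply: code_in => //; exact: redS_code.
have [|w0 [r0 c0 l0 i0]] := IH w1; first by lia.
exists w0; split; [exact: r0| | |].
- by apply: HKtrans c0; rewrite wE; apply: cong_in; exact: redS_cong.
- by lia.
have -> : << w >> - << w0 >> = (<< w >> - << w1 >>) + (<< w1 >> - << w0 >>) :> A.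
  by rewrite addrA subrK.
apply: iGD; last exact: i0.
have -> : << w >> - << w1 >> =
    << FMonom s >> * (<< FMonom p.1 >> - << FMonom p.2 >>) * << FMonom t >> :> A.
  by rewrite mulUBU !mmul_cat -!catA wE.
have pG : ideal_gen (binomials k (redS' n)) (<< FMonom p.1 >> - << FMonom p.2 >>).
  by apply: ideal_genW; exists p.
have [pG' _] := iGM << FMonom s >> _ pG.
by have [_ pG''] := iGM << FMonom t >> _ pG'.
Qed.

Lemma reduced_independent f : (forall w, w \in msupp f -> reduced (redS' n) w) ->
  nat_hom f = 0 -> f = 0.
Proof.
move=> fr f0; apply/malgP => w; rewrite mcoeff0.
case: (boolP (w \in msupp f)) => [wf|/mcoeff_outdom //].
rewrite -(nat_hom_coef (w := w)) ?f0 ?mcoeff0 // => u uf uw.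
exact: (reduced_cong hn (fr _ uf) (fr _ wf) uw).
Qed.

Lemma msupp_sumU (P : set (F n)) (T : eqType) (s : seq T) (c : T -> k) (h : T -> F n) :
  (forall x, P (h x)) ->
  forall w, w \in msupp (\sum_(x <- s) << c x *g h x >> : A) -> P w.
Proof.
move=> Ph w; rewrite -mcoeff_neq0 => H; apply: contrapT => nP.
move/eqP: H; apply; rewrite raddf_sum big1 //= => x _.
by rewrite mcoeffU; case: eqP => // e; case: nP; rewrite -e.
Qed.

Lemma big_deglex_max (s : seq (F n))
    (m := \big[@deglex_max n/mone]_(w <- s) w) :
  (m = mone \/ m \in s) /\ forall w, w \in s -> (code w <= code m)%N.
Proof.
rewrite /m {m}; elim: s => [|x t [IH1 IH2]]; first by rewrite big_nil; split; [left|].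
rewrite big_cons; set m := (X in deglex_max _ X) in IH1 IH2 *.
rewrite /deglex_max deglexE //; case: leqP => xm; split.
- by case: IH1 => mt; [left|right; rewrite inE mt orbT].
- by move=> y; rewrite inE => /orP[/eqP->//|/IH2].
- by right; rewrite mem_head.
move=> y; rewrite inE => /orP[/eqP-> //|/IH2 ym].
exact: leq_trans ym (ltnW xm).
Qed.

Lemma lead_monP f : f != 0 -> lead_mon f \in msupp f /\
  forall w, w \in msupp f -> (code w <= code (lead_mon f))%N.
Proof.
move=> f0; have [w wf] : exists w, w \in msupp f.
  by apply/fset0Pn; rewrite msupp_eq0.
have [H1 H2] := big_deglex_max (msupp f).
rewrite -/(lead_mon f) in H1 H2; split=> //; case: H1 => // m1.
(* if the maximum is the initial value 1, then so is every word of the support *)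
have := H2 w wf; rewrite m1 => wm; suff -> : mone = w by [].
apply/eqP; rewrite fmP; apply/eqP/(code_inj hn)/eqP; rewrite eqn_leq wm andbT.
by rewrite fm1 /code /= addn0 expn0; have := expn_gt0 n (size w); lia.
Qed.

Lemma lead_binomial u v : (code v < code u)%N ->
  lead_mon (<< u >> - << v >> : A) = u /\ (<< u >> - << v >> : A) != 0.
Proof.
move=> vu; set f := _ - _.
have uv : v != u by apply: contraTneq vu => ->; rewrite ltnn.
have uf : u \in msupp f.
  by rewrite -mcoeff_neq0 /f mcoeffB !mcoeffU eqxx (negbTE uv) subr0 oner_eq0.
have f0 : f != 0 by apply: contraTneq uf => ->; rewrite msupp0 in_fset0.
split=> //; have [lf lm] := lead_monP f0.
have := fsubsetP (msuppB_le _ _) _ lf; rewrite !msuppU1 !inE.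
case/orP=> /eqP // lv; have := lm u uf; rewrite lv; lia.
Qed.

(** The rules only enter through irreducible words, so that the same argument
    serves for the small set, for the large set, and for any set in between. *)
Lemma grobner_between (R : set (seq 'I_n * seq 'I_n)) :
  redS' n `<=` R -> R `<=` redS n -> grobner_basis (binomials k R).
Proof.
move=> S'R RS.
have GJ : binomials k R `<=` J k n.
  move=> _ [p /RS Sp <-]; apply/JE; rewrite nat_homB !nat_homU.
  by rewrite ((C_eqP _ _).2 (redS_cong hn Sp)) subrr.
have [nf nfP] := choice normal_form_exists.
split; [exact: GJ| | |].
- case=> p /RS /(redS_code hn) lt /eqP; apply/negP.
  by have [] := lead_binomial (u := FMonom p.1) (v := FMonom p.2) lt.
- apply/seteqP; split=> [f|f fJ I iI GI]; first by apply; [exact: J_ideal|].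
  (* f minus its normal form h is a combination of the generators, and h = 0 *)
  pose h : A := \sum_(w <- msupp f) << f@_w *g nf w >>.
  have h0 : h = 0.
    apply: reduced_independent; first by apply: msupp_sumU => w; case: (nfP w).
    rewrite -[RHS]((JE f).1 fJ) (nat_homE f) nat_hom_sum; apply: eq_bigr => w _.
    by rewrite nat_homU; case: (nfP w) => _ /C_eqP-> _ _.
  rewrite -[f]subr0 -h0 [X in X - _]monalgE -sumrB; apply: ideal_sum => // w _.
  have -> : << f@_w *g w >> - << f@_w *g nf w >> =
      (f@_w)%:MP * (<< w >> - << nf w >>) :> A.
    by rewrite mulCB.
  have [_ _ iM] := iI.
  suff Iw : I (<< w >> - << nf w >>).
    by have [Iw' _] := iM (f@_w)%:MP _ Iw; exact: Iw'.
  have [_ _ _ Iw] := nfP w; apply: Iw; first exact: iI.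
  by move=> g [p /S'R Rp <-]; apply: GI; exists p.
move=> f fJ f0; apply: contrapT => nG.
have [lf lm] := lead_monP f0; set w := lead_mon f in lf lm nG.
(* an irreducible leading word keeps its nonzero coefficient in the image of f:
   a congruent word of the support would reduce to it, hence be larger *)
have rw : reduced (redS' n) w.
  move=> p Sp; apply/negP => pw; apply: nG.
  exists (<< FMonom p.1 >> - << FMonom p.2 >>); first by exists p => //; exact: S'R.
  have [-> //] := lead_binomial (u := FMonom p.1) (v := FMonom p.2)
    (redS_code hn (redS'_redS Sp)).
move: lf; rewrite -mcoeff_neq0 -(nat_hom_coef (w := w)) ?((JE f).1 fJ) ?mcoeff0 ?eqxx //.
move=> u uf uw; have [ru uc le _] := nfP u.
have nw : nf u = w by apply: reduced_cong => //; exact: HKtrans (HKsym uc) uw.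
apply/eqP; rewrite fmP; apply/eqP/(code_inj hn)/eqP.
by rewrite eqn_leq lm //= -nw.
Qed.

Lemma reduced_basis : basis_family (reduced (redS' n)) (word_img k).
Proof.
split=> [c cr|v]; first by rewrite -nat_homZ; exact: reduced_independent.
have [nf nfP] := choice normal_form_exists.
exists (\sum_(x <- msupp v) << v@_x *g nf (repr x) >>).
  by apply: (msupp_sumU (h := nf \o repr)) => x; case: (nfP (repr x)).
rewrite -nat_homZ nat_hom_sum {1}[v]monalgE; apply: eq_bigr => x _.
by rewrite nat_homU; case: (nfP (repr x)) => _ /C_eqP <- _ _; rewrite reprK.
Qed.

Lemma size_run (i j : 'I_n) : (size (run i j) <= n)%N.
Proof.
rewrite /run; case: ifP => _; rewrite ?size_rev size_filter.
all: by rewrite -[X in (_ <= X)%N]size_enum_ord count_size.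
Qed.

Lemma size_uniq_ord (s : seq 'I_n) : uniq s -> (size s <= n)%N.
Proof. by move/card_uniqP <-; rewrite -[X in (_ <= X)%N](card_ord n) max_card. Qed.

Lemma size_flatten_run (bs : seq ('I_n * 'I_n)) :
  (size (flatten [seq run b.1 b.2 | b <- bs]) <= size bs * n)%N.
Proof.
by elim: bs => //= b bs IH; rewrite size_cat mulSn leq_add // size_run.
Qed.

(** A crude bound: the inner words without repetition have at most [n] letters,
    and the increasing bounds leave room for at most [n] runs of at most [n]
    letters each. *)
Lemma redS'_size p : redS' n p -> (size p.1 <= n * n + n + 2)%N.
Proof.
have U (i j0 : 'I_n) (u : seq 'I_n) : i \notin u -> j0 \notin u ->
    (forall j, j != i -> j != j0 -> (count_mem j u <= 1)%N) -> (size u <= n)%N.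
  move=> iu ju H; apply/size_uniq_ord/count_mem_uniq => x.
  case: (boolP (x \in u)) => [xu|/count_memPn //]; apply/eqP.
  rewrite eqn_leq -[X in _ && X]has_count has_pred1 xu andbT; apply: H.
    by apply: contraNneq iu => <-.
  by apply: contraNneq ju => <-.
have nn : (0 <= n * n)%N by [].
case=> {p} [_ [i|i j _|x1 xn i j _ _ _]|i u _ /andP[ui uj] H|i v _ /andP[vi vj] H
    |x1 xn i z bs _ _ z0 iz _ _ s1 _ E] /=; try lia.
- by rewrite size_cat /=; have := size_run x1 i; lia.
- rewrite size_cat /=; apply: (@leq_ltn_trans (n + 1)%N); [rewrite leq_add2r|lia].
  by apply: U H; apply/count_memPn/eqP.
- rewrite size_cat /=; apply: (@leq_ltn_trans (n + 1)%N); [rewrite leq_add2r|lia].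
  by apply: U H; apply/count_memPn/eqP.
have := congr1 size E; rewrite /= !size_cat /=.
have := size_run x1 i; have := size_flatten_run bs.
have : (size bs <= n)%N.
  rewrite -(size_map fst); apply: size_uniq_ord.
  have := sorted_uniq ltn_trans ltnn s1; rewrite rcons_uniq => /andP[_].
  by rewrite (map_comp (fun x : 'I_n => (val x).+1) fst) => /map_uniq.
move=> bn; have : (size bs * n <= n * n)%N by rewrite leq_mul2r bn orbT.
lia.
Qed.

Lemma finite_redS' : finite_set (redS' n).
Proof.
pose B := (n * n + n + 2)%N.
apply: (@sub_finite_set _ _ ((fun q : B.-bseq 'I_n * B.-bseq 'I_n =>
    (val q.1, val q.2)) @` [set: _])).
  move=> p Sp; have p1 := redS'_size Sp.
  have p2 : (size p.2 <= B)%N.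
    have := redS_code hn (redS'_redS Sp); case: (leqP (size p.2) (size p.1)).
      by move=> le _; exact: leq_trans p1.
    by move/(code_ltn_size hn); lia.
  by exists (Bseq p1, Bseq p2) => //=; case: (p).
by apply: finite_image; exact: finite_finset.
Qed.
End Algebra.

Theorem theorem4p4 (n : nat) (k : fieldType) (hn : (3 <= n)%N) :
  finite_set (binomials k (redS' n)) /\
  grobner_basis (binomials k (redS' n)) /\
  grobner_basis (binomials k (redS n)) /\
  basis_family (reduced (redS' n)) (word_img k).
Proof.
split; first by apply: finite_image; exact: finite_redS'.
split; first by apply: grobner_between => // p; exact: redS'_redS.
split; first by apply: grobner_between => // p; exact: redS'_redS.
exact: reduced_basis.
Qed.
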